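(* Let $\varphi(z)=1+B_1z+B_2z^2+B_3z^3+\cdots$ be analytic in $\mathbb{D}$ with $B_1>0$ and $B_2\in\mathbb{R}$. Let $f(z)=z+\sum_{n\ge2}a_nz^n$ belong to $\sigma$, with inverse $F=f^{-1}$ on $\mathbb{D}$, and suppose \[1+\frac{zf''(z)}{f'(z)}\prec\varphi(z)\quad\text{and}\quad F'(w)\prec\varphi(w)\] (i.e. $f\in\mathcal{K}(\varphi)$ and $F\in\mathcal{R}(\varphi)$). Then \[|a_2|\le\sqrt{\frac{3\,(B_1+|B_2-B_1|)}{8}}\quad\text{and}\quad |a_3|\le\frac{5\,(B_1+|B_2-B_1|)}{12}.\]
   Context: $\mathbb{D}=\{z\in\mathbb{C}:|z|<1\}$. $\mathcal{A}$ denotes the class of analytic functions $f$ on $\mathbb{D}$ with $f(0)=0$, $f'(0)=1$, i.e. $f(z)=z+\sum_{n\ge2}a_nz^n$. The class $\sigma$ of bi-univalent functions consists of those $f\in\mathcal{A}$ that are univalent in $\mathbb{D}$ and whose inverse $f^{-1}$ (defined near $0$) extends to a univalent analytic function $F$ on $\mathbb{D}$; then $F(w)=w-a_2w^2+(2a_2^2-a_3)w^3+\cdots$. For analytic $g,h$ on $\mathbb{D}$, $g\prec h$ (subordination) means there is an analytic $\omega:\mathbb{D}\to\mathbb{D}$ with $\omega(0)=0$ and $g=h\circ\omega$. *)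

(* Defs.v *)
From Stdlib Require Import Reals Lra.
Open Scope R_scope.

Definition Cx : Type := (R * R)%type.
Definition RtoC (x : R) : Cx := (x, 0).
Definition Cre (z : Cx) : R := fst z.
Definition Cim (z : Cx) : R := snd z.
Definition Czero : Cx := (0, 0).
Definition Cone : Cx := (1, 0).
Definition Cadd (z w : Cx) : Cx := (fst z + fst w, snd z + snd w).
Definition Copp (z : Cx) : Cx := (- fst z, - snd z).
Definition Csub (z w : Cx) : Cx := Cadd z (Copp w).
Definition Cmul (z w : Cx) : Cx :=
  (fst z * fst w - snd z * snd w, fst z * snd w + snd z * fst w).
Definition Cinv (z : Cx) : Cx :=
  (fst z / (fst z ^ 2 + snd z ^ 2), - snd z / (fst z ^ 2 + snd z ^ 2)).
Definition Cdiv (z w : Cx) : Cx := Cmul z (Cinv w).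
Definition Cmod (z : Cx) : R := sqrt (fst z ^ 2 + snd z ^ 2).

Definition inD (z : Cx) : Prop := Cmod z < 1.

Definition has_cderiv (f : Cx -> Cx) (z l : Cx) : Prop :=
  forall eps : R, 0 < eps -> exists delta : R, 0 < delta /\
    forall h : Cx, 0 < Cmod h < delta ->
      Cmod (Csub (Cdiv (Csub (f (Cadd z h)) (f z)) h) l) < eps.

Definition is_deriv_on_D (f f' : Cx -> Cx) : Prop :=
  forall z : Cx, inD z -> has_cderiv f z (f' z).

Definition analytic_on_D (f : Cx -> Cx) : Prop :=
  forall z : Cx, inD z -> exists l : Cx, has_cderiv f z l.

Definition univalent_on_D (f : Cx -> Cx) : Prop :=
  forall z w : Cx, inD z -> inD w -> f z = f w -> z = w.

Definition subordinate (g h : Cx -> Cx) : Prop :=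
  exists omega : Cx -> Cx,
    analytic_on_D omega /\ omega Czero = Czero /\
    (forall z : Cx, inD z -> inD (omega z) /\ g z = h (omega z)).

(* Main.v *)
(** Write 1 + z f''/f' = phi(u) and F' = phi(v) with Schwarz functions u and v.
    If g = phi(w) has second coefficient c and w(z) = w1 z + w2 z^2 + ..., then
    c = B1 (w2 + w1^2) + (B2 - B1) w1^2, so |c| <= B1 + |B2 - B1| as soon as
    |w1| <= 1 and |w2 + w1^2| <= 1.  Up to a factor 2 these are the first two
    coefficients of (1 + w)/(1 - w), which has nonnegative real part, and they are
    bounded by Caratheodory's inequality.  Applied to u and v this bounds
    6 a3 - 4 a2^2 and 6 a2^2 - 3 a3, and 8 a2^2 and 12 a3 are combinations of
    the two with weights (1, 2) and (3, 2).

    Caratheodory's inequality comes from the mean value property on circles, for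
    functions which are only assumed complex differentiable: in the coordinates
    z = exp(s + i t) it is Goursat's theorem on the rectangle
    [s0, s1] x [0, 2 pi], whose horizontal sides cancel by periodicity. *)

From Stdlib Require Import Reals Lra Lia Classical ClassicalEpsilon.
From Coquelicot Require Import Coquelicot.
Open Scope R_scope.

(** * Goursat's theorem on rectangles *)

(** Every left end lies below every right end ([Hcross]), so the supremum of the left ends belongs
    to all the intervals. *)
Lemma nested_intervals (X : nat -> R) (w : R) :
  0 <= w ->
  (forall n, X n <= X (S n) /\ X (S n) + (/ 2) ^ S n * w <= X n + (/ 2) ^ n * w) ->
  exists p, forall n, X n <= p <= X n + (/ 2) ^ n * w.
Proof.
intros Hw HX.
assert (Hpos : forall n, 0 <= (/ 2) ^ n * w).
{ intros n; apply Rmult_le_pos; [apply pow_le; lra | exact Hw]. }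
assert (Hle : forall n k, X n <= X (n + k)%nat /\
   X (n + k)%nat + (/ 2) ^ (n + k) * w <= X n + (/ 2) ^ n * w).
{ intros n k; induction k as [|k IH].
  - rewrite Nat.add_0_r; lra.
  - rewrite Nat.add_succ_r; specialize (HX (n + k)%nat); lra. }
assert (Hcross : forall n m, X n <= X m + (/ 2) ^ m * w).
{ intros n m; destruct (Nat.le_ge_cases n m) as [H|H].
  - specialize (Hle n (m - n)%nat). replace (n + (m - n))%nat with m in Hle by lia.
    specialize (Hpos m); lra.
  - specialize (Hle m (n - m)%nat). replace (m + (n - m))%nat with n in Hle by lia.
    specialize (Hpos n); lra. }
destruct (completeness (fun x => exists n, x = X n)) as [p [Hub Hlub]].
- exists (X 0%nat + (/ 2) ^ 0 * w); intros x [n ->]; apply Hcross.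
- exists (X 0%nat); exists 0%nat; reflexivity.
- exists p; intros n; split.
  + apply Hub; exists n; reflexivity.
  + apply Hlub; intros x [m ->]; apply Hcross.
Qed.

(** Read [P x y l] as a property of the rectangle with lower left corner (x, y) and sides l w and l
    h. If it failed at scale 1 it would fail on a quarter, then on a quarter of that quarter, and so
    on; the bad rectangles shrink to a common point, where the local hypothesis makes all small ones
    good. *)
Lemma rectangle_bisection (w h x0 y0 : R) (P : R -> R -> R -> Prop) :
  0 <= w -> 0 <= h ->
  (forall x y l, P x y (/ 2 * l) -> P (x + / 2 * l * w) y (/ 2 * l) ->
     P x (y + / 2 * l * h) (/ 2 * l) ->
     P (x + / 2 * l * w) (y + / 2 * l * h) (/ 2 * l) -> P x y l) ->
  (forall p q, exists delta, 0 < delta /\ forall x y l, 0 < l < delta ->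
     x <= p <= x + l * w -> y <= q <= y + l * h -> P x y l) ->
  P x0 y0 1.
Proof.
intros Hw Hh Hquarter Hlocal.
apply NNPP; intros Hbad.
(* Each bad corner is carried with the proof that it is bad, so that the sequence [sq] can be
   defined by recursion. *)
assert (step : forall (n : nat) (u : {u : R * R | ~ P (fst u) (snd u) ((/ 2) ^ n)}),
  {v : {v : R * R | ~ P (fst v) (snd v) ((/ 2) ^ S n)} |
    (fst (proj1_sig u) <= fst (proj1_sig v) /\
     fst (proj1_sig v) + (/ 2) ^ S n * w <= fst (proj1_sig u) + (/ 2) ^ n * w) /\
    (snd (proj1_sig u) <= snd (proj1_sig v) /\
     snd (proj1_sig v) + (/ 2) ^ S n * h <= snd (proj1_sig u) + (/ 2) ^ n * h)}).
{ intros n [[x y] Hu]; simpl in Hu |- *; apply constructive_indefinite_description.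
  set (l := (/ 2) ^ n) in *.
  assert (Hl : 0 <= l) by (apply pow_le; lra).
  assert (0 <= l * w) by (apply Rmult_le_pos; assumption).
  assert (0 <= l * h) by (apply Rmult_le_pos; assumption).
  apply NNPP; intros Hno; apply Hu; apply Hquarter; apply NNPP; intros Hq; apply Hno;
  match type of Hq with ~ P ?a ?b _ => exists (exist _ (a, b) Hq) end; simpl; lra. }
pose (sq := fix sq n : {u : R * R | ~ P (fst u) (snd u) ((/ 2) ^ n)} :=
  match n with
  | O => exist _ (x0, y0) Hbad
  | S m => proj1_sig (step m (sq m))
  end).
assert (Hsq : forall n,
    (fst (proj1_sig (sq n)) <= fst (proj1_sig (sq (S n))) /\
     fst (proj1_sig (sq (S n))) + (/ 2) ^ S n * w <= fst (proj1_sig (sq n)) + (/ 2) ^ n * w) /\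
    (snd (proj1_sig (sq n)) <= snd (proj1_sig (sq (S n))) /\
     snd (proj1_sig (sq (S n))) + (/ 2) ^ S n * h <= snd (proj1_sig (sq n)) + (/ 2) ^ n * h)).
{ intros n; exact (proj2_sig (step n (sq n))). }
destruct (nested_intervals (fun n => fst (proj1_sig (sq n))) w Hw) as [p Hp];
  [intros n; apply Hsq|].
destruct (nested_intervals (fun n => snd (proj1_sig (sq n))) h Hh) as [q Hq];
  [intros n; apply Hsq|].
destruct (Hlocal p q) as [delta [Hdelta HP]].
destruct (pow_lt_1_zero (/ 2)) with (y := delta) as [n Hn];
  [rewrite Rabs_pos_eq; lra | exact Hdelta |].
specialize (Hn n (le_n n)).
assert (0 < (/ 2) ^ n) by (apply pow_lt; lra).
rewrite Rabs_pos_eq in Hn by lra.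
apply (proj2_sig (sq n)).
apply HP; [lra | apply Hp | apply Hq].
Qed.

(** For G = U + i V this is the imaginary part of the integral of G dz, taken counterclockwise
    around [a, b] x [c, d]. *)
Definition boundary_integral (U V : R -> R -> R) (a b c d : R) : R :=
  RInt (fun s => V s c) a b + RInt (U b) c d - RInt (fun s => V s d) a b - RInt (U a) c d.

Lemma continuity_2d_pt_continuous_l (f : R -> R -> R) (x y : R) :
  continuity_2d_pt f x y -> continuous (fun u => f u y) x.
Proof.
intros H; apply filterlim_locally; intros eps.
destruct (H eps) as [delta Hd]; exists delta; intros u Hu.
apply Hd; [exact Hu | rewrite Rminus_diag, Rabs_R0; apply cond_pos].
Qed.

Lemma continuity_2d_pt_continuous_r (f : R -> R -> R) (x y : R) :
  continuity_2d_pt f x y -> continuous (f x) y.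
Proof.
intros H; apply filterlim_locally; intros eps.
destruct (H eps) as [delta Hd]; exists delta; intros u Hu.
apply Hd; [rewrite Rminus_diag, Rabs_R0; apply cond_pos | exact Hu].
Qed.

Lemma ex_RInt_slice_l (f : R -> R -> R) (a b y : R) :
  a <= b -> (forall x, a <= x <= b -> continuity_2d_pt f x y) ->
  ex_RInt (fun u => f u y) a b.
Proof.
intros Hab Hf; apply (ex_RInt_continuous (V := R_CompleteNormedModule)).
rewrite Rmin_left, Rmax_right by exact Hab; intros z Hz.
apply continuity_2d_pt_continuous_l, Hf, Hz.
Qed.

Lemma ex_RInt_slice_r (f : R -> R -> R) (x c d : R) :
  c <= d -> (forall y, c <= y <= d -> continuity_2d_pt f x y) -> ex_RInt (f x) c d.
Proof.
intros Hcd Hf; apply (ex_RInt_continuous (V := R_CompleteNormedModule)).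
rewrite Rmin_left, Rmax_right by exact Hcd; intros z Hz.
apply continuity_2d_pt_continuous_r, Hf, Hz.
Qed.

Lemma RInt_split (f : R -> R) (a m b : R) :
  a <= m <= b -> ex_RInt f a b -> RInt f a b = RInt f a m + RInt f m b.
Proof.
intros Hm Hf; symmetry; apply (RInt_Chasles (V := R_CompleteNormedModule)).
- apply (ex_RInt_Chasles_1 f a m b Hm Hf).
- apply (ex_RInt_Chasles_2 f a m b Hm Hf).
Qed.

(** Each inner segment is traversed once in each direction by neighbouring quarters, so its
    contributions cancel. *)
Lemma boundary_integral_quarter (U V : R -> R -> R) (a m b c n d : R) :
  a <= m <= b -> c <= n <= d ->
  (forall x y, a <= x <= b -> c <= y <= d -> continuity_2d_pt U x y) ->
  (forall x y, a <= x <= b -> c <= y <= d -> continuity_2d_pt V x y) ->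
  boundary_integral U V a b c d =
    boundary_integral U V a m c n + boundary_integral U V m b c n +
    boundary_integral U V a m n d + boundary_integral U V m b n d.
Proof.
intros Hm Hn HU HV; unfold boundary_integral.
assert (HUx : forall x, a <= x <= b -> ex_RInt (U x) c d).
{ intros x Hx; apply ex_RInt_slice_r; [lra | intros y Hy; apply HU; lra]. }
assert (HVy : forall y, c <= y <= d -> ex_RInt (fun s => V s y) a b).
{ intros y Hy; apply ex_RInt_slice_l; [lra | intros x Hx; apply HV; lra]. }
rewrite (RInt_split (fun s => V s c) a m b), (RInt_split (fun s => V s d) a m b),
  (RInt_split (U a) c n d), (RInt_split (U b) c n d);
  try lra; first [apply HUx | apply HVy]; lra.
Qed.

Lemma is_RInt_diff_plus_const (f g : R -> R) (a b k : R) :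
  ex_RInt f a b -> ex_RInt g a b ->
  is_RInt (fun s => f s - g s + k) a b (RInt f a b - RInt g a b + (b - a) * k).
Proof.
intros Hf Hg.
apply (is_RInt_plus (V := R_NormedModule) (fun s => f s - g s) (fun _ => k)).
- apply (is_RInt_minus (V := R_NormedModule) f g);
    apply (RInt_correct (V := R_CompleteNormedModule)); assumption.
- apply (is_RInt_const (V := R_NormedModule)).
Qed.

(** The affine parts contribute - lx (d - c) (b - a) through [V] and + lx (b - a) (d - c) through
    [U]; they cancel because the same lx occurs in both. On each pair of opposite sides there
    remains a difference of two errors, at most 2 M. *)
Lemma boundary_integral_small (U V : R -> R -> R) (a b c d p q lx ly mx M : R) :
  a <= b -> c <= d ->
  (forall x y, a <= x <= b -> c <= y <= d -> continuity_2d_pt U x y) ->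
  (forall x y, a <= x <= b -> c <= y <= d -> continuity_2d_pt V x y) ->
  (forall x y, a <= x <= b -> c <= y <= d ->
     Rabs (U x y - U p q - (lx * (x - p) + ly * (y - q))) <= M) ->
  (forall x y, a <= x <= b -> c <= y <= d ->
     Rabs (V x y - V p q - (mx * (x - p) + lx * (y - q))) <= M) ->
  Rabs (boundary_integral U V a b c d) <= 2 * M * ((b - a) + (d - c)).
Proof.
intros Hab Hcd HUc HVc HU HV.
assert (HUx : forall x, a <= x <= b -> ex_RInt (U x) c d).
{ intros x Hx; apply ex_RInt_slice_r; [lra | intros y Hy; apply HUc; lra]. }
assert (HVy : forall y, c <= y <= d -> ex_RInt (fun s => V s y) a b).
{ intros y Hy; apply ex_RInt_slice_l; [lra | intros x Hx; apply HVc; lra]. }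
assert (I1 := is_RInt_diff_plus_const _ _ a b (lx * (d - c)) (HVy c ltac:(lra)) (HVy d ltac:(lra))).
assert (I2 := is_RInt_diff_plus_const _ _ c d (- (lx * (b - a))) (HUx b ltac:(lra)) (HUx a ltac:(lra))).
assert (H1 : Rabs (RInt (fun s => V s c - V s d + lx * (d - c)) a b) <= (b - a) * (2 * M)).
{ apply abs_RInt_le_const; [exact Hab | eexists; exact I1 |].
  intros s Hs.
  pose proof (HV s c Hs ltac:(lra)) as A; pose proof (HV s d Hs ltac:(lra)) as B.
  apply Rabs_le_between in A; apply Rabs_le_between in B; apply Rabs_le_between; lra. }
assert (H2 : Rabs (RInt (fun t => U b t - U a t + - (lx * (b - a))) c d) <= (d - c) * (2 * M)).
{ apply abs_RInt_le_const; [exact Hcd | eexists; exact I2 |].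
  intros t Ht.
  pose proof (HU a t ltac:(lra) Ht) as A; pose proof (HU b t ltac:(lra) Ht) as B.
  apply Rabs_le_between in A; apply Rabs_le_between in B; apply Rabs_le_between; lra. }
rewrite (is_RInt_unique _ _ _ _ I1) in H1; rewrite (is_RInt_unique _ _ _ _ I2) in H2.
apply Rabs_le_between in H1; apply Rabs_le_between in H2.
unfold boundary_integral; apply Rabs_le_between; lra.
Qed.

(* Goursat's bisection argument for the form V ds + U dt, which is closed
   because U_s = V_t (both are called lx below). *)
Lemma goursat_rectangle (U V : R -> R -> R) (a b c d : R) :
  a < b -> c < d ->
  (forall x y, a <= x <= b -> c <= y <= d -> exists lx ly mx,
     differentiable_pt_lim U x y lx ly /\ differentiable_pt_lim V x y mx lx) ->
  boundary_integral U V a b c d = 0.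
Proof.
intros Hab Hcd HUV.
assert (HUc : forall x y, a <= x <= b -> c <= y <= d -> continuity_2d_pt U x y).
{ intros x y Hx Hy; destruct (HUV x y Hx Hy) as (lx & ly & mx & HU & _).
  apply differentiable_continuity_pt; exists lx, ly; exact HU. }
assert (HVc : forall x y, a <= x <= b -> c <= y <= d -> continuity_2d_pt V x y).
{ intros x y Hx Hy; destruct (HUV x y Hx Hy) as (lx & ly & mx & _ & HV).
  apply differentiable_continuity_pt; exists mx, lx; exact HV. }
enough (Hall : forall K, 0 < K -> Rabs (boundary_integral U V a b c d) <= K).
{ apply Rabs_eq_0, Rle_antisym; [|apply Rabs_pos].
  apply le_epsilon; intros eps Heps; rewrite Rplus_0_l; apply Hall, Heps. }
intros K HK.
set (w := b - a); set (h := d - c).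
assert (Hw : 0 < w) by (unfold w; lra); assert (Hh : 0 < h) by (unfold h; lra).
(* The bound K l^2 passes from the quarters to the whole, since 4 K (l / 2)^2 = K l^2. *)
pose (P x y l := 0 <= l -> a <= x -> x + l * w <= b -> c <= y -> y + l * h <= d ->
  Rabs (boundary_integral U V x (x + l * w) y (y + l * h)) <= K * l ^ 2).
assert (HP : P a c 1).
{ apply (rectangle_bisection w h); try lra.
  - intros x y l H1 H2 H3 H4 Hl Hx1 Hx2 Hy1 Hy2.
    assert (0 <= l * w) by (apply Rmult_le_pos; lra).
    assert (0 <= l * h) by (apply Rmult_le_pos; lra).
    rewrite (boundary_integral_quarter U V x (x + / 2 * l * w) _ y (y + / 2 * l * h)) by
      (try lra; intros; first [apply HUc | apply HVc]; lra).
    unfold P in H1, H2, H3, H4.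
    specialize (H1 ltac:(lra) ltac:(lra) ltac:(lra) ltac:(lra) ltac:(lra)).
    specialize (H2 ltac:(lra) ltac:(lra) ltac:(lra) ltac:(lra) ltac:(lra)).
    specialize (H3 ltac:(lra) ltac:(lra) ltac:(lra) ltac:(lra) ltac:(lra)).
    specialize (H4 ltac:(lra) ltac:(lra) ltac:(lra) ltac:(lra) ltac:(lra)).
    replace (x + / 2 * l * w + / 2 * l * w) with (x + l * w) in * by field.
    replace (y + / 2 * l * h + / 2 * l * h) with (y + l * h) in * by field.
    replace (K * (/ 2 * l) ^ 2) with (K * l ^ 2 / 4) in * by field.
    apply Rabs_le_between in H1; apply Rabs_le_between in H2.
    apply Rabs_le_between in H3; apply Rabs_le_between in H4.
    apply Rabs_le_between; lra.
  - intros p q.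
    destruct (classic ((a <= p <= b) /\ (c <= q <= d))) as [[Hp Hq]|Hout].
    (* A point outside [a, b] x [c, d] lies in no subrectangle, so [P] holds vacuously around it. *)
    2:{ exists 1; split; [lra|]; intros x y l _ Hx Hy _ ? ? ? ?; exfalso; apply Hout; lra. }
    destruct (HUV p q Hp Hq) as (lx & ly & mx & HU & HV).
    (* This tolerance eps solves 2 (eps l (w + h)) (l w + l h) = K l^2. *)
    assert (Heps : 0 < K / (2 * (w + h) ^ 2)).
    { apply Rdiv_lt_0_compat; [exact HK | apply Rmult_lt_0_compat; [lra | apply pow_lt; lra]]. }
    destruct (HU (mkposreal _ Heps)) as [d1 Hd1], (HV (mkposreal _ Heps)) as [d2 Hd2].
    simpl in Hd1, Hd2; set (eps := K / (2 * (w + h) ^ 2)) in *.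
    pose proof (cond_pos d1); pose proof (cond_pos d2).
    exists (Rmin d1 d2 / (w + h)); split.
    { apply Rdiv_lt_0_compat; [apply Rmin_pos|]; lra. }
    intros x y l [Hl0 Hl] Hx Hy _ Hx1 Hx2 Hy1 Hy2.
    assert (Hlwh : l * (w + h) < Rmin d1 d2).
    { apply (Rmult_lt_compat_r (w + h)) in Hl; [|lra].
      replace (Rmin d1 d2 / (w + h) * (w + h)) with (Rmin d1 d2) in Hl by (field; lra).
      exact Hl. }
    pose proof (Rmin_l d1 d2); pose proof (Rmin_r d1 d2).
    assert (0 <= l * w) by (apply Rmult_le_pos; lra).
    assert (0 <= l * h) by (apply Rmult_le_pos; lra).
    eapply Rle_trans.
    + apply (boundary_integral_small U V _ _ _ _ p q lx ly mx (eps * (l * (w + h)))); try lra;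
        try (intros; first [apply HUc | apply HVc]; lra);
        intros u v Hu Hv;
        (eapply Rle_trans;
         [first [apply Hd1 | apply Hd2]; apply Rabs_lt_between; lra
         |apply Rmult_le_compat_l; [lra|]; apply Rmax_lub; apply Rabs_le_between; lra]).
    + right; unfold eps; field; lra. }
unfold P in HP; specialize (HP ltac:(lra) ltac:(lra) ltac:(unfold w; lra) ltac:(lra) ltac:(unfold h; lra)).
replace (a + 1 * w) with b in HP by (unfold w; ring).
replace (c + 1 * h) with d in HP by (unfold h; ring).
lra.
Qed.
(** * Complex differentiation *)

(** The uniform structure is the one induced by [C_AbsRing], so that balls are discs for [Cmod]. *)
Definition ccont (f : C -> C) (z : C) : Prop :=
  @continuous (AbsRing_UniformSpace C_AbsRing) (AbsRing_UniformSpace C_AbsRing) f z.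

Lemma ccontP (f : C -> C) (z : C) :
  ccont f z <-> forall eps, 0 < eps -> exists delta, 0 < delta /\
    forall w, Cmod (w - z) < delta -> Cmod (f w - f z) < eps.
Proof.
split.
- intros H eps Heps.
  destruct (proj1 (filterlim_locally _ _) H (mkposreal eps Heps)) as [d Hd].
  exists d; split; [apply cond_pos | exact Hd].
- intros H; apply filterlim_locally; intros eps.
  destruct (H eps (cond_pos eps)) as (d & Hd0 & Hd).
  exists (mkposreal d Hd0); exact Hd.
Qed.

Lemma ccont_const (a z : C) : ccont (fun _ => a) z.
Proof. apply (@continuous_const (AbsRing_UniformSpace C_AbsRing) (AbsRing_UniformSpace C_AbsRing)). Qed.

Lemma ccont_id (z : C) : ccont (fun w => w) z.
Proof. apply (@continuous_id (AbsRing_UniformSpace C_AbsRing)). Qed.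

Lemma ccont_plus (f g : C -> C) (z : C) :
  ccont f z -> ccont g z -> ccont (fun w => f w + g w)%C z.
Proof. apply (continuous_plus (U := AbsRing_UniformSpace C_AbsRing) (V := AbsRing_NormedModule C_AbsRing)). Qed.

Lemma ccont_opp (f : C -> C) (z : C) : ccont f z -> ccont (fun w => - f w)%C z.
Proof. apply (continuous_opp (U := AbsRing_UniformSpace C_AbsRing) (V := AbsRing_NormedModule C_AbsRing)). Qed.

Lemma ccont_minus (f g : C -> C) (z : C) :
  ccont f z -> ccont g z -> ccont (fun w => f w - g w)%C z.
Proof. intros Hf Hg; apply ccont_plus; [exact Hf | apply ccont_opp, Hg]. Qed.

Lemma ccont_mult (f g : C -> C) (z : C) :
  ccont f z -> ccont g z -> ccont (fun w => f w * g w)%C z.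
Proof. apply (continuous_mult (U := AbsRing_UniformSpace C_AbsRing) (K := C_AbsRing)). Qed.

Lemma ccont_comp (f g : C -> C) (z : C) :
  ccont g z -> ccont f (g z) -> ccont (fun w => f (g w)) z.
Proof.
apply (@continuous_comp (AbsRing_UniformSpace C_AbsRing)
  (AbsRing_UniformSpace C_AbsRing) (AbsRing_UniformSpace C_AbsRing)). Qed.

Lemma ccont_ext_loc (f g : C -> C) (z : C) (d : R) : 0 < d ->
  (forall w, Cmod (w - z) < d -> f w = g w) -> ccont f z -> ccont g z.
Proof.
intros Hd Hfg Hf; apply (@continuous_ext_loc (AbsRing_UniformSpace C_AbsRing) (AbsRing_UniformSpace C_AbsRing) g f); [|exact Hf].
exists (mkposreal d Hd); exact Hfg.
Qed.

Lemma Cmod_minus_lower (x y : C) : Cmod y - Cmod x <= Cmod (x - y).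
Proof.
pose proof (Cmod_triangle (y - x) x) as H.
replace (y - x + x)%C with y in H by ring.
rewrite <- (Cmod_opp (x - y)); replace (- (x - y))%C with (y - x)%C by ring; lra.
Qed.

(** Since |w| > |z| / 2, the denominator of (z - w) / (w z) has modulus above |z|^2 / 2. *)
Lemma Cinv_bound (w z : C) (d : R) : z <> 0 ->
  d <= Cmod z / 2 -> Cmod (w - z) < d ->
  w <> 0 /\ Cmod (/ w - / z) <= 2 / (Cmod z ^ 2) * Cmod (w - z).
Proof.
intros Hz Hd Hw.
pose proof (Cmod_minus_lower w z) as Hlow.
assert (Hz0 : 0 < Cmod z) by (apply Cmod_gt_0; exact Hz).
assert (Hw0 : w <> 0) by (apply Cmod_gt_0; lra).
split; [exact Hw0|].
replace (/ w - / z)%C with ((z - w) / (w * z))%C by (field; split; assumption).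
rewrite Cmod_div by (apply Cmult_neq_0; assumption).
rewrite Cmod_mult, <- (Cmod_opp (w - z)).
replace (- (w - z))%C with (z - w)%C by ring.
unfold Rdiv; rewrite Rmult_comm; apply Rmult_le_compat_r; [apply Cmod_ge_0|].
replace (2 * / Cmod z ^ 2) with (/ (Cmod z / 2 * Cmod z)) by (field; lra).
apply Rinv_le_contravar; [apply Rmult_lt_0_compat; lra|].
apply Rmult_le_compat_r; lra.
Qed.

Lemma ccont_Cinv (z : C) : z <> 0 -> ccont Cinv z.
Proof.
intros Hz; apply ccontP; intros eps Heps.
assert (Hz0 : 0 < Cmod z) by (apply Cmod_gt_0; exact Hz).
assert (Hk : 0 < eps * (Cmod z ^ 2 / 2)).
{ apply Rmult_lt_0_compat; [exact Heps|]; pose proof (pow_lt _ 2 Hz0); lra. }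
exists (Rmin (Cmod z / 2) (eps * (Cmod z ^ 2 / 2))); split; [apply Rmin_pos; lra|].
intros w Hw; destruct (Cinv_bound w z _ Hz (Rmin_l _ _) Hw) as [_ H].
eapply Rle_lt_trans; [exact H|].
pose proof (Rmin_r (Cmod z / 2) (eps * (Cmod z ^ 2 / 2))).
replace eps with (2 / Cmod z ^ 2 * (eps * (Cmod z ^ 2 / 2))) by (field; lra).
apply Rmult_lt_compat_l; [|lra].
apply Rdiv_lt_0_compat; [lra | apply pow_lt, Hz0].
Qed.

Lemma ccont_inv (f : C -> C) (z : C) : f z <> 0 -> ccont f z -> ccont (fun w => / f w)%C z.
Proof. intros H Hf; apply (ccont_comp Cinv f); [exact Hf | apply ccont_Cinv, H]. Qed.

Ltac ccont_auto :=
  lazymatch goal with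
  | |- ccont (fun z => (@?f z + @?g z)%C) _ => apply (ccont_plus f g); ccont_auto
  | |- ccont (fun z => (@?f z - @?g z)%C) _ => apply (ccont_minus f g); ccont_auto
  | |- ccont (fun z => (@?f z * @?g z)%C) _ => apply (ccont_mult f g); ccont_auto
  | |- ccont (fun z => (- @?f z)%C) _ => apply (ccont_opp f); ccont_auto
  | |- ccont (fun z => z) _ => apply ccont_id
  | |- ccont (fun _ => _) _ => first [apply ccont_const | assumption | idtac]
  | |- _ => try assumption
  end.

(* Caratheodory's form of the derivative. *)
Definition cderiv (f : C -> C) (z l : C) : Prop :=
  exists s : C -> C, ccont s z /\ s z = l /\
    forall w, f w = (f z + s w * (w - z))%C.

Lemma cderivP (f : C -> C) (z l : C) :
  cderiv f z l <-> forall eps, 0 < eps -> exists delta, 0 < delta /\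
    forall h, 0 < Cmod h < delta -> Cmod ((f (z + h)%C - f z) / h - l) < eps.
Proof.
split.
- intros (s & Hs & Hsz & Hf) eps Heps.
  destruct (proj1 (ccontP s z) Hs eps Heps) as (d & Hd & Hsd).
  exists d; split; [exact Hd|]; intros h Hh.
  assert (Hh0 : h <> 0) by (apply Cmod_gt_0; lra).
  specialize (Hsd (z + h)%C); replace (z + h - z)%C with h in Hsd by ring.
  rewrite Hf, <- Hsz.
  replace ((f z + s (z + h)%C * (z + h - z) - f z) / h - s z)%C with (s (z + h)%C - s z)%C.
  + apply Hsd; lra.
  + field; exact Hh0.
- intros H.
  (* The slope is the difference quotient completed by l at w = z; its continuity there is the limit
     in question. *)
  exists (fun w => if Ceq_dec w z then l else ((f w - f z) / (w - z))%C).
  repeat split.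
  + apply ccontP; intros eps Heps; destruct (H eps Heps) as (d & Hd & Hfd).
    exists d; split; [exact Hd|]; intros w Hw.
    destruct (Ceq_dec z z) as [_|Hn]; [|contradiction].
    destruct (Ceq_dec w z) as [Hwz|Hwz].
    * unfold Cminus; rewrite Cplus_opp_r, Cmod_0; exact Heps.
    * specialize (Hfd (w - z)%C); replace (z + (w - z))%C with w in Hfd by ring.
      apply Hfd; split; [|exact Hw].
      apply Cmod_gt_0, Cminus_eq_contra, Hwz.
  + destruct (Ceq_dec z z) as [_|Hn]; [reflexivity | contradiction].
  + intros w; destruct (Ceq_dec w z) as [->|Hwz]; [ring|].
    field; apply Cminus_eq_contra, Hwz.
Qed.

Lemma cderiv_ext_loc (f g : C -> C) (z l : C) (d : R) : 0 < d ->
  (forall w, Cmod (w - z) < d -> f w = g w) -> cderiv f z l -> cderiv g z l.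
Proof.
intros Hd Hfg; rewrite !cderivP; intros H eps Heps.
destruct (H eps Heps) as (d' & Hd' & Hf).
exists (Rmin d d'); split; [apply Rmin_pos; assumption|]; intros h Hh.
pose proof (Rmin_l d d'); pose proof (Rmin_r d d').
rewrite <- !Hfg; [apply Hf; lra | |].
- replace (z - z)%C with (RtoC 0) by ring; rewrite Cmod_0; exact Hd.
- replace (z + h - z)%C with h by ring; lra.
Qed.

Lemma cderiv_unique (f : C -> C) (z l l' : C) : cderiv f z l -> cderiv f z l' -> l = l'.
Proof.
rewrite !cderivP; intros H H'.
apply NNPP; intros Hne.
assert (He : 0 < Cmod (l - l') / 2).
{ pose proof (proj1 (Cmod_gt_0 _) (Cminus_eq_contra _ _ Hne)); lra. }
destruct (H _ He) as (d & Hd & Hf), (H' _ He) as (d' & Hd' & Hf').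
pose proof (Rmin_pos d d' Hd Hd').
pose proof (Rmin_l d d'); pose proof (Rmin_r d d').
specialize (Hf (RtoC (Rmin d d' / 2))); specialize (Hf' (RtoC (Rmin d d' / 2))).
rewrite Cmod_R, Rabs_pos_eq in Hf, Hf' by lra.
set (q := ((f (z + RtoC (Rmin d d' / 2)) - f z) / RtoC (Rmin d d' / 2))%C) in *.
specialize (Hf ltac:(lra)); specialize (Hf' ltac:(lra)).
pose proof (Cmod_triangle (q - l') (- (q - l))) as T; rewrite Cmod_opp in T.
replace (q - l' + - (q - l))%C with (l - l')%C in T by ring; lra.
Qed.

Lemma cderiv_ccont (f : C -> C) (z l : C) : cderiv f z l -> ccont f z.
Proof.
intros (s & Hs & _ & Hf).
apply (ccont_ext_loc (fun w => f z + s w * (w - z))%C f z 1 Rlt_0_1).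
- intros w _; symmetry; apply Hf.
- apply ccont_plus; [apply ccont_const|].
  apply ccont_mult; [exact Hs|].
  apply ccont_minus; [apply ccont_id | apply ccont_const].
Qed.

Lemma cderiv_const (a z : C) : cderiv (fun _ => a) z 0.
Proof.
exists (fun _ => RtoC 0); repeat split; [apply ccont_const|]; intros w; ring.
Qed.

Lemma cderiv_id (z : C) : cderiv (fun w => w) z 1.
Proof.
exists (fun _ => RtoC 1); repeat split; [apply ccont_const|]; intros w; ring.
Qed.

Lemma cderiv_plus (f g : C -> C) (z l m : C) :
  cderiv f z l -> cderiv g z m -> cderiv (fun w => f w + g w)%C z (l + m).
Proof.
intros (s & Hs & <- & Hf) (t & Ht & <- & Hg).
exists (fun w => s w + t w)%C; repeat split; [apply ccont_plus; assumption|].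
intros w; rewrite Hf, Hg; ring.
Qed.

Lemma cderiv_mult (f g : C -> C) (z l m : C) :
  cderiv f z l -> cderiv g z m ->
  cderiv (fun w => f w * g w)%C z (l * g z + f z * m).
Proof.
intros Df Dg; pose proof (cderiv_ccont g z m Dg) as Cg.
destruct Df as (s & Hs & <- & Hf), Dg as (t & Ht & <- & Hg).
exists (fun w => s w * g w + f z * t w)%C; repeat split.
- apply ccont_plus; apply ccont_mult; try assumption; apply ccont_const.
- intros w; rewrite Hf, (Hg w); ring.
Qed.

(** The slopes multiply, so points w with g w = g z call for no separate case. *)
Lemma cderiv_comp (f g : C -> C) (z l m : C) :
  cderiv f (g z) l -> cderiv g z m -> cderiv (fun w => f (g w)) z (l * m).
Proof.
intros (s & Hs & <- & Hf) Dg; pose proof (cderiv_ccont g z m Dg) as Cg.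
destruct Dg as (t & Ht & <- & Hg).
exists (fun w => s (g w) * t w)%C; repeat split.
- apply ccont_mult; [apply (ccont_comp s g)|]; assumption.
- intros w; rewrite (Hf (g w)); rewrite (Hg w) at 2; ring.
Qed.

Lemma cderiv_Cinv (z : C) : z <> 0 -> cderiv Cinv z (- / (z * z)).
Proof.
intros Hz; apply cderivP; intros eps Heps.
assert (Hz0 : 0 < Cmod z) by (apply Cmod_gt_0; exact Hz).
(* The difference quotient of 1 / w at z simplifies to - 1 / ((z + h) z), whose limit is read off by
   continuity. *)
assert (Hc : ccont (fun w => - / (w * z))%C z).
{ apply ccont_opp, ccont_inv; [apply Cmult_neq_0; exact Hz|].
  apply ccont_mult; [apply ccont_id | apply ccont_const]. }
destruct (proj1 (ccontP _ _) Hc eps Heps) as (d & Hd & Hcd).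
exists (Rmin d (Cmod z)); split; [apply Rmin_pos; assumption|]; intros h Hh.
pose proof (Rmin_l d (Cmod z)); pose proof (Rmin_r d (Cmod z)).
assert (Hh0 : h <> 0) by (apply Cmod_gt_0; lra).
assert (Hzh : (z + h)%C <> 0).
{ apply Cmod_gt_0; pose proof (Cmod_minus_lower (- h) z) as L.
  rewrite Cmod_opp, <- (Cmod_opp (- h - z)) in L.
  replace (- (- h - z))%C with (z + h)%C in L by ring; lra. }
specialize (Hcd (z + h)%C); replace (z + h - z)%C with h in Hcd by ring.
replace ((/ (z + h) - / z) / h - - / (z * z))%C
  with (- / ((z + h) * z) - - / (z * z))%C by (field; repeat split; assumption).
apply Hcd; lra.
Qed.

Lemma cderiv_inv (f : C -> C) (z l : C) :
  f z <> 0 -> cderiv f z l -> cderiv (fun w => / f w)%C z (- / (f z * f z) * l).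
Proof. intros Hfz Df; apply (cderiv_comp Cinv); [apply cderiv_Cinv, Hfz | exact Df]. Qed.
(** * The mean value property *)

(** Cauchy-Riemann: multiplication by l is the real matrix with rows (Re l, - Im l) and (Im l, Re
    l), and the complex remainder dominates both of its coordinates. *)
Lemma differentiable_pt_lim_Re (G : C -> C) (x y : R) (l : C) :
  cderiv G (x, y) l ->
  differentiable_pt_lim (fun u v => Re (G (u, v))) x y (Re l) (- Im l) /\
  differentiable_pt_lim (fun u v => Im (G (u, v))) x y (Im l) (Re l).
Proof.
intros (s & Hs & <- & HG).
enough (Hrem : forall eps, 0 < eps -> exists d : posreal, forall u v,
   Rabs (u - x) < d -> Rabs (v - y) < d ->
   Cmod (G (u, v) - G (x, y) - s (x, y) * ((u, v) - (x, y)))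
     <= eps * Rmax (Rabs (u - x)) (Rabs (v - y))).
{ split; intros eps; destruct (Hrem eps (cond_pos eps)) as [d Hd]; exists d;
  intros u v Hu Hv; eapply Rle_trans; try apply (Hd u v Hu Hv);
  (eapply Rle_trans; [|apply Rmax_Cmod]); unfold Re, Im.
  - eapply Rle_trans; [|apply Rmax_l]; right; f_equal; simpl; ring.
  - eapply Rle_trans; [|apply Rmax_r]; right; f_equal; simpl; ring. }
intros eps Heps.
assert (Hs2 : 0 < sqrt 2) by (apply sqrt_lt_R0; lra).
(* The factor sqrt 2 compares the modulus with the maximum norm of [differentiable_pt_lim]. *)
destruct (proj1 (ccontP _ _) Hs (eps / sqrt 2)) as (d & Hd & Hsd);
  [apply Rdiv_lt_0_compat; assumption|].
assert (Hd2 : 0 < d / sqrt 2) by (apply Rdiv_lt_0_compat; assumption).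
exists (mkposreal _ Hd2); simpl; intros u v Hu Hv.
assert (Hmod : Cmod ((u, v) - (x, y)) <= sqrt 2 * Rmax (Rabs (u - x)) (Rabs (v - y)))
  by apply Cmod_2Rmax.
assert (Hlt : Cmod ((u, v) - (x, y)) < d).
{ eapply Rle_lt_trans; [exact Hmod|].
  replace d with (sqrt 2 * (d / sqrt 2)) by (field; lra).
  apply Rmult_lt_compat_l; [exact Hs2 | apply Rmax_lub_lt; assumption]. }
rewrite (HG (u, v)).
replace (G (x, y) + s (u, v) * ((u, v) - (x, y)) - G (x, y) - s (x, y) * ((u, v) - (x, y)))%C
  with ((s (u, v) - s (x, y)) * ((u, v) - (x, y)))%C by ring.
rewrite Cmod_mult.
replace (eps * Rmax (Rabs (u - x)) (Rabs (v - y))) with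
  (eps / sqrt 2 * (sqrt 2 * Rmax (Rabs (u - x)) (Rabs (v - y)))) by (field; lra).
apply Rmult_le_compat; try apply Cmod_ge_0; [left; apply Hsd, Hlt | exact Hmod].
Qed.

Definition polar (r t : R) : C := (r * cos t, r * sin t).

Lemma Cmod_polar (r t : R) : 0 <= r -> Cmod (polar r t) = r.
Proof.
intros Hr; unfold Cmod, polar; simpl.
replace (_ + _) with (r ^ 2 * (Rsqr (sin t) + Rsqr (cos t))) by (unfold Rsqr; ring).
rewrite sin2_cos2, Rmult_1_r; apply sqrt_pow2, Hr.
Qed.

(** Both products are composites with (u, v) -> u v. The coordinates of exp(s + i t) obey the
    Cauchy-Riemann equations, which is why U_s = V_t survives the change of variables. *)
Lemma differentiable_pt_lim_polar (x y : R) :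
  differentiable_pt_lim (fun s t => exp s * cos t) x y (exp x * cos y) (- (exp x * sin y)) /\
  differentiable_pt_lim (fun s t => exp s * sin t) x y (exp x * sin y) (exp x * cos y).
Proof.
assert (Hmul : forall a b, differentiable_pt_lim (fun u v => u * v) a b b a).
{ intros a b eps; exists eps; intros u v Hu Hv.
  replace (u * v - a * b - (b * (u - a) + a * (v - b))) with ((u - a) * (v - b)) by ring.
  rewrite Rabs_mult; apply Rmult_le_compat; try apply Rabs_pos; [lra | apply Rmax_r]. }
assert (Hproj : forall g a b l, derivable_pt_lim g b l ->
  differentiable_pt_lim (fun _ v => g v) a b 0 l).
{ intros g a b l Hg eps.
  destruct (differentiable_pt_lim_proj1_0 g b a l Hg eps) as [d Hd].
  exists d; intros u v Hu Hv; specialize (Hd v u Hv Hu).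
  rewrite Rmax_comm; replace (0 * (u - a) + l * (v - b)) with (l * (v - b) + 0 * (u - a)) by ring.
  exact Hd. }
assert (He := differentiable_pt_lim_proj1_0 exp x y _ (derivable_pt_lim_exp x)).
split.
- assert (H := differentiable_pt_lim_comp _ _ _ x y _ _ _ _ _ _ (Hmul _ _) He
    (Hproj cos x y _ (derivable_pt_lim_cos y))).
  cbv beta in H.
  replace (exp x * cos y) with (cos y * exp x + exp x * 0) by ring.
  replace (- (exp x * sin y)) with (cos y * 0 + exp x * - sin y) by ring.
  exact H.
- assert (H := differentiable_pt_lim_comp _ _ _ x y _ _ _ _ _ _ (Hmul _ _) He
    (Hproj sin x y _ (derivable_pt_lim_sin y))).
  cbv beta in H.
  replace (exp x * sin y) with (sin y * exp x + exp x * 0) by ring.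
  replace (exp x * cos y) with (sin y * 0 + exp x * cos y) by ring.
  exact H.
Qed.

Section MeanValue.

Context (G : C -> C) (HG : forall z : C, z <> 0 -> Cmod z < 1 -> exists l, cderiv G z l).

Let U s t := Re (G (polar (exp s) t)).
Let V s t := Im (G (polar (exp s) t)).

Lemma polar_differentiable (s t : R) : s < 0 -> exists lx ly mx,
  differentiable_pt_lim U s t lx ly /\ differentiable_pt_lim V s t mx lx.
Proof.
intros Hs; pose proof (exp_pos s) as He.
assert (Hmod : Cmod (polar (exp s) t) = exp s) by (apply Cmod_polar; lra).
destruct (HG (polar (exp s) t)) as [l Hl].
- apply Cmod_gt_0; lra.
- rewrite Hmod, <- exp_0; apply exp_increasing, Hs.
- destruct (differentiable_pt_lim_Re G _ _ l Hl) as [HRe HIm].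
  destruct (differentiable_pt_lim_polar s t) as [Hx Hy].
  assert (H1 := differentiable_pt_lim_comp _ _ _ s t _ _ _ _ _ _ HRe Hx Hy).
  assert (H2 := differentiable_pt_lim_comp _ _ _ s t _ _ _ _ _ _ HIm Hx Hy).
  cbv beta in H1, H2.
  exists (Re l * (exp s * cos t) + - Im l * (exp s * sin t)); eexists; eexists.
  split; [exact H1|].
  replace (Re l * (exp s * cos t) + - Im l * (exp s * sin t)) with
    (Im l * - (exp s * sin t) + Re l * (exp s * cos t)) by ring.
  exact H2.
Qed.

Lemma polar_continuity (s t : R) : s < 0 -> continuity_2d_pt U s t.
Proof.
intros Hs; destruct (polar_differentiable s t Hs) as (lx & ly & mx & H & _).
apply differentiable_continuity_pt; exists lx, ly; exact H.
Qed.

Lemma circle_integral_const (a b : R) :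
  a < b < 0 -> RInt (U a) 0 (2 * PI) = RInt (U b) 0 (2 * PI).
Proof.
intros Hab; pose proof PI_RGT_0.
assert (H0 : boundary_integral U V a b 0 (2 * PI) = 0).
{ apply goursat_rectangle; try lra; intros x y Hx _; apply polar_differentiable; lra. }
unfold boundary_integral in H0.
replace (RInt (fun s => V s (2 * PI)) a b) with (RInt (fun s => V s 0) a b) in H0; [lra|].
apply RInt_ext; intros s _; unfold V, polar; rewrite cos_2PI, sin_2PI, cos_0, sin_0.
reflexivity.
Qed.

(** The integral does not depend on the radius, and for small radii continuity at 0 makes it close
    to 2 pi Re (G 0). The origin is handled by continuity because the function [G] used below
    contains a Taylor remainder factor known only to be continuous there. *)
Lemma circle_mean_value (r : R) : ccont G 0 -> 0 < r < 1 ->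
  is_RInt (fun t => Re (G (polar r t))) 0 (2 * PI) (2 * PI * Re (G 0)).
Proof.
intros HG0 Hr; pose proof PI_RGT_0.
assert (Hlr : ln r < 0) by (rewrite <- ln_1; apply ln_increasing; lra).
assert (Hex : forall s, s < 0 -> ex_RInt (U s) 0 (2 * PI)).
{ intros s Hs; apply ex_RInt_slice_r; [lra|]; intros t _; apply polar_continuity, Hs. }
enough (Heq : RInt (U (ln r)) 0 (2 * PI) = 2 * PI * Re (G 0)).
{ rewrite <- Heq; unfold U; rewrite exp_ln by lra.
  assert (H1 := RInt_correct (V := R_CompleteNormedModule) _ _ _ (Hex (ln r) Hlr)).
  unfold U in H1; rewrite exp_ln in H1 by lra; exact H1. }
apply Rminus_diag_uniq, Rabs_eq_0, Rle_antisym; [|apply Rabs_pos].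
apply le_epsilon; intros eps Heps; rewrite Rplus_0_l.
assert (Heps' : 0 < eps / (2 * PI)) by (apply Rdiv_lt_0_compat; lra).
destruct (proj1 (ccontP G 0) HG0 _ Heps') as (d & Hd & HGd).
(* A radius below d, so that G is close to G 0 on the circle, and below r, so that the two circle
   integrals can be compared. *)
set (m := Rmin d r / 2).
assert (Hm : 0 < m /\ m < d /\ m < r).
{ pose proof (Rmin_l d r); pose proof (Rmin_r d r); pose proof (Rmin_pos d r).
  unfold m; lra. }
assert (Hlm : ln m < ln r) by (apply ln_increasing; lra).
rewrite <- (circle_integral_const (ln m) (ln r)) by lra.
assert (HI := is_RInt_diff_plus_const (U (ln m)) (fun _ => Re (G 0)) 0 (2 * PI) 0
  (Hex (ln m) ltac:(lra)) (ex_RInt_const _ _ _)).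
rewrite RInt_const in HI.
replace (RInt (U (ln m)) 0 (2 * PI) - 2 * PI * Re (G 0)) with
  (RInt (fun s => U (ln m) s - Re (G 0) + 0) 0 (2 * PI)).
- replace eps with ((2 * PI - 0) * (eps / (2 * PI))) by (field; lra).
  apply abs_RInt_le_const; [lra | eexists; exact HI |].
  intros t _; unfold U; rewrite exp_ln, Rplus_0_r by lra.
  specialize (HGd (polar m t)).
  replace (polar m t - 0)%C with (polar m t) in HGd by ring.
  rewrite Cmod_polar in HGd by lra.
  specialize (HGd ltac:(lra)).
  apply Rlt_le; eapply Rle_lt_trans; [|exact HGd].
  eapply Rle_trans; [|apply Rmax_Cmod]; apply Rmax_l.
- rewrite (is_RInt_unique _ _ _ _ HI); unfold scal; simpl; unfold mult; simpl; ring.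
Qed.

End MeanValue.
(** * Second order expansions at 0 *)

(* The remainder is written s z * z^2 with s continuous at 0 and s 0 = c, so that
   no regularity away from 0 is needed and the calculus is purely algebraic. *)
Definition taylor2 (f : C -> C) (a b c : C) : Prop :=
  exists s : C -> C, ccont s 0 /\ s 0 = c /\
    forall z, f z = (a + b * z + s z * (z * z))%C.

Lemma taylor2_ext_loc (f g : C -> C) (a b c : C) (d : R) : 0 < d ->
  (forall z, Cmod z < d -> f z = g z) -> taylor2 f a b c -> taylor2 g a b c.
Proof.
intros Hd Hfg (s & Hs & <- & Hf).
(* Beyond radius d the factor is obtained by solving the expansion for it, which is possible because
   z is nonzero there. *)
exists (fun z => if Rlt_dec (Cmod z) d then s z else ((g z - (a + b * z)) / (z * z))%C).
repeat split.
- apply (ccont_ext_loc s _ 0 d Hd); [|exact Hs].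
  intros w Hw; replace (w - 0)%C with w in Hw by ring.
  destruct (Rlt_dec (Cmod w) d); [reflexivity | contradiction].
- destruct (Rlt_dec (Cmod 0) d) as [_|Hn]; [reflexivity|].
  exfalso; apply Hn; rewrite Cmod_0; exact Hd.
- intros z; destruct (Rlt_dec (Cmod z) d) as [Hz|Hz].
  + rewrite <- Hfg by exact Hz; apply Hf.
  + field; intros ->; apply Hz; rewrite Cmod_0; exact Hd.
Qed.

Lemma taylor2_coef (f : C -> C) (a b c a' b' c' : C) :
  taylor2 f a b c -> a = a' -> b = b' -> c = c' -> taylor2 f a' b' c'.
Proof. intros H -> -> ->; exact H. Qed.

Lemma taylor2_const (a : C) : taylor2 (fun _ => a) a 0 0.
Proof. exists (fun _ => RtoC 0); repeat split; [apply ccont_const | intros z; ring]. Qed.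

Lemma taylor2_id : taylor2 (fun z => z) 0 1 0.
Proof. exists (fun _ => RtoC 0); repeat split; [apply ccont_const | intros z; ring]. Qed.

Lemma taylor2_plus (f g : C -> C) (a b c a' b' c' : C) :
  taylor2 f a b c -> taylor2 g a' b' c' ->
  taylor2 (fun z => f z + g z)%C (a + a') (b + b') (c + c').
Proof.
intros (s & Hs & <- & Hf) (t & Ht & <- & Hg).
exists (fun z => s z + t z)%C; repeat split; [apply ccont_plus; assumption|].
intros z; rewrite Hf, Hg; ring.
Qed.

Lemma taylor2_mult (f g : C -> C) (a b c a' b' c' : C) :
  taylor2 f a b c -> taylor2 g a' b' c' ->
  taylor2 (fun z => f z * g z)%C (a * a') (a * b' + b * a') (a * c' + b * b' + c * a').
Proof.
intros (s & Hs & <- & Hf) (t & Ht & <- & Hg).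
exists (fun z => a * t z + b * b' + s z * a' + (b * t z + b' * s z) * z + s z * t z * (z * z))%C.
repeat split.
- ccont_auto.
- ring.
- intros z; rewrite Hf, Hg; ring.
Qed.

Lemma taylor2_comp (f g : C -> C) (a b c b' c' : C) :
  taylor2 f a b c -> taylor2 g 0 b' c' ->
  taylor2 (fun z => f (g z)) a (b * b') (b * c' + c * (b' * b')).
Proof.
intros (s & Hs & <- & Hf) (t & Ht & <- & Hg).
assert (Hg0 : g 0 = 0) by (rewrite Hg; ring).
assert (Hcg : ccont g 0).
{ apply (ccont_ext_loc (fun z => 0 + b' * z + t z * (z * z))%C _ _ 1 Rlt_0_1);
    [intros w _; symmetry; apply Hg|].
  ccont_auto. }
(* As g z = z (b' + t z z), the square of g z carries the factor z^2. *)
exists (fun z => b * t z + s (g z) * ((b' + t z * z) * (b' + t z * z)))%C; repeat split.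
- ccont_auto.
  apply (ccont_comp s g); [exact Hcg | rewrite Hg0; exact Hs].
- rewrite Hg0; ring.
- intros z; rewrite Hf; set (k := s (g z)); rewrite Hg; ring.
Qed.

(** One has 1 - f (1 - b z) = (b^2 - s + b s z) z^2; dividing by f gives the remainder. The division
    takes place on a disc where |f - 1| < 1, hence f is nonzero. *)
Lemma taylor2_Cinv_1 (f : C -> C) (b c : C) :
  taylor2 f 1 b c -> taylor2 (fun z => / f z)%C 1 (- b) (b * b - c).
Proof.
intros (s & Hs & <- & Hf).
assert (Hf0 : f 0 = 1) by (rewrite Hf; ring).
assert (Hcf : ccont f 0).
{ apply (ccont_ext_loc (fun z => 1 + b * z + s z * (z * z))%C _ _ 1 Rlt_0_1);
    [intros w _; symmetry; apply Hf|].
  ccont_auto. }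
destruct (proj1 (ccontP f 0) Hcf 1 Rlt_0_1) as (d & Hd & Hfd).
apply (taylor2_ext_loc (fun z => 1 + - b * z + (b * b - s z + b * s z * z) * / f z * (z * z))%C
  _ _ _ _ d Hd).
- intros z Hz; specialize (Hfd z).
  replace (z - 0)%C with z in Hfd by ring; specialize (Hfd Hz).
  assert (Hfz : f z <> 0).
  { intros E; rewrite E, Hf0 in Hfd; replace (0 - 1)%C with (- (1))%C in Hfd by ring.
    rewrite Cmod_m1 in Hfd; lra. }
  replace (1 + - b * z + (b * b - s z + b * s z * z) * / f z * (z * z))%C with
    ((f z * (1 - b * z) + (b * b - s z + b * s z * z) * (z * z)) / f z)%C
    by (field; exact Hfz).
  replace (f z * (1 - b * z) + (b * b - s z + b * s z * z) * (z * z))%C with (RtoC 1)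
    by (rewrite Hf; ring).
  field; exact Hfz.
- exists (fun z => (b * b - s z + b * s z * z) * / f z)%C; repeat split.
  + apply ccont_mult; [|apply ccont_inv; [rewrite Hf0; exact C1_nz | exact Hcf]].
    ccont_auto.
  + rewrite Hf0; field; exact C1_nz.
Qed.

Lemma taylor2_intro (f : C -> C) (a b c : C) :
  (forall eps, 0 < eps -> exists d, 0 < d /\ forall z, Cmod z < d ->
     Cmod (f z - (a + b * z + c * (z * z))) <= eps * Cmod z ^ 2) ->
  taylor2 f a b c.
Proof.
intros H.
exists (fun z => if Ceq_dec z 0 then c else ((f z - (a + b * z)) / (z * z))%C).
assert (H0 : (if Ceq_dec 0 0 then c else ((f 0 - (a + b * 0)) / (0 * 0))%C) = c)
  by (destruct (Ceq_dec 0 0); [reflexivity | contradiction]).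
repeat split; [| exact H0 |].
- apply ccontP; intros eps Heps; destruct (H (eps / 2)) as (d & Hd & Hfd); [lra|].
  exists d; split; [exact Hd|]; intros z Hz; rewrite H0.
  replace (z - 0)%C with z in Hz by ring.
  destruct (Ceq_dec z 0) as [_|Hz0].
  + replace (c - c)%C with (RtoC 0) by ring; rewrite Cmod_0; exact Heps.
  + assert (Hm : 0 < Cmod z) by (apply Cmod_gt_0; exact Hz0).
    replace ((f z - (a + b * z)) / (z * z) - c)%C with
      ((f z - (a + b * z + c * (z * z))) / (z * z))%C by (field; exact Hz0).
    rewrite Cmod_div, Cmod_mult by (apply Cmult_neq_0; exact Hz0).
    apply Rle_lt_trans with (eps / 2); [|lra].
    apply Rle_div_l; [apply Rmult_lt_0_compat; exact Hm|].
    replace (Cmod z * Cmod z) with (Cmod z ^ 2) by ring; apply Hfd, Hz.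
- intros z; destruct (Ceq_dec z 0) as [->|Hz]; [|field; exact Hz].
  (* The estimate at z = 0 itself forces f 0 = a. *)
  destruct (H 1 Rlt_0_1) as (d & Hd & Hfd).
  specialize (Hfd 0); rewrite Cmod_0 in Hfd; specialize (Hfd Hd).
  apply Ceq_minus, Cmod_eq_0, Rle_antisym; [|apply Cmod_ge_0].
  simpl in Hfd; lra.
Qed.

Lemma cderiv_derivable_Re (f : C -> C) (t : R) (l : C) :
  cderiv f t l -> derivable_pt_lim (fun u => Re (f (RtoC u))) t (Re l).
Proof.
intros H; destruct (differentiable_pt_lim_Re f t 0 l H) as [HRe _].
replace (Re l) with (Re l * 1 + - Im l * 0) by ring.
apply (derivable_pt_lim_comp_2d (fun u v => Re (f (u, v))) (fun u => u) (fun _ => 0)).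
- exact HRe.
- apply derivable_pt_lim_id.
- apply derivable_pt_lim_const.
Qed.

(** With e = f z - f 0, the real mean value theorem is applied to t -> Re (conj(e) f(t z)). Its
    increment over [0, 1] is |e|^2, whence |e|^2 <= |e| M |z|. *)
Lemma mean_value_inequality (f df : C -> C) (z : C) (M : R) :
  (forall t, 0 <= t <= 1 -> cderiv f (t * z) (df (t * z)%C) /\ Cmod (df (t * z)%C) <= M) ->
  Cmod (f z - f 0) <= M * Cmod z.
Proof.
intros H.
set (e := (f z - f 0)%C).
destruct (MVT_cor2 (fun t => Re (Cconj e * f (RtoC t * z)))%C
  (fun t => Re (Cconj e * (df (RtoC t * z) * z)))%C 0 1 Rlt_0_1) as (t & Ht & Ht01).
- intros t Ht; apply (cderiv_derivable_Re (fun w => Cconj e * f (w * z))%C).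
  replace (Cconj e * (df (t * z) * z))%C
    with (0 * f (t * z) + Cconj e * (df (t * z)%C * (1 * z + t * 0)))%C by ring.
  apply (cderiv_mult (fun _ => Cconj e) (fun w => f (w * z)%C)); [apply cderiv_const|].
  apply (cderiv_comp f (fun w => w * z)%C); [apply H, Ht|].
  apply (cderiv_mult (fun w => w) (fun _ => z)); [apply cderiv_id | apply cderiv_const].
- rewrite Rminus_0_r, Rmult_1_r, Cmult_1_l, Cmult_0_l in Ht.
  replace (Re (Cconj e * f z) - Re (Cconj e * f 0)) with (Cmod e * Cmod e) in Ht.
  2:{ replace (Re (Cconj e * f z) - Re (Cconj e * f 0)) with (Re (Cconj e * e))
        by (unfold e, Re; simpl; ring).
      unfold Cmod; rewrite sqrt_sqrt by nra; unfold Re; simpl; ring. }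
  assert (Hle : Cmod e * Cmod e <= Cmod e * (M * Cmod z)).
  { rewrite Ht; eapply Rle_trans; [apply Rle_abs|].
    eapply Rle_trans; [eapply Rle_trans; [apply Rmax_l | apply Rmax_Cmod]|].
    rewrite !Cmod_mult.
    replace (Cmod (Cconj e)) with (Cmod e) by (unfold Cmod; simpl; f_equal; ring).
    apply Rmult_le_compat_l; [apply Cmod_ge_0|].
    apply Rmult_le_compat_r; [apply Cmod_ge_0|]; apply H; lra. }
  destruct (Rle_lt_or_eq_dec 0 (Cmod e) (Cmod_ge_0 e)) as [He|He].
  + apply Rmult_le_reg_l in Hle; assumption.
  + rewrite <- He; apply Rmult_le_pos; [|apply Cmod_ge_0].
    eapply Rle_trans; [apply Cmod_ge_0 | apply (H 0); lra].
Qed.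

(** The error E of the quadratic polynomial has derivative g w - g 0 - c w = o(w), so the mean value
    inequality on the segment from 0 to z gives E z - E 0 = o(z^2). *)
Lemma taylor2_of_derivatives (f g : C -> C) (c : C) :
  (forall z, Cmod z < 1 -> cderiv f z (g z)) -> cderiv g 0 c ->
  taylor2 f (f 0) (g 0) (c / 2).
Proof.
intros Hf (s & Hs & <- & Hg).
apply taylor2_intro; intros eps Heps.
destruct (proj1 (ccontP s 0) Hs eps Heps) as (d & Hd & Hsd).
exists (Rmin d 1); split; [apply Rmin_pos; lra|]; intros z Hz.
pose proof (Rmin_l d 1); pose proof (Rmin_r d 1).
set (k := s 0) in *.
set (E := fun w => (f w - (f 0 + g 0 * w + k / 2 * (w * w)))%C).
replace (f z - (f 0 + g 0 * z + k / 2 * (z * z)))%C with (E z - E 0)%C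
  by (unfold E; ring).
replace (eps * Cmod z ^ 2) with (eps * Cmod z * Cmod z) by ring.
apply (mean_value_inequality E (fun w => g w - (g 0 + k * w))%C); intros t Ht.
assert (Hle : Cmod (t * z) <= Cmod z).
{ rewrite Cmod_mult, Cmod_R, Rabs_pos_eq by lra.
  rewrite <- (Rmult_1_l (Cmod z)) at 2; apply Rmult_le_compat_r; [apply Cmod_ge_0 | lra]. }
split.
- set (w := (t * z)%C) in *.
  (* The derivative is put in the shape that the sum and product rules produce. *)
  replace (g w - (g 0 + k * w))%C with
    (g w + (0 * (f 0 + g 0 * w + k / 2 * (w * w)) + (- (1)) *
       (0 + (0 * w + g 0 * 1) + (0 * (w * w) + k / 2 * (1 * w + w * 1)))))%C.
  2:{ replace (k * w)%C with (k / 2 * (w + w))%C; [ring|].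
      field; intros E2; injection E2; lra. }
  apply (cderiv_ext_loc (fun u => f u + (- (1)) * (f 0 + g 0 * u + k / 2 * (u * u)))%C _ _ _ 1 Rlt_0_1).
  { intros u _; unfold E; ring. }
  apply cderiv_plus; [apply Hf; lra|].
  apply (cderiv_mult (fun _ => (- (1))%C) (fun u => f 0 + g 0 * u + k / 2 * (u * u))%C); [apply cderiv_const|].
  apply cderiv_plus; [apply cderiv_plus; [apply cderiv_const|]|].
  + apply (cderiv_mult (fun _ => g 0) (fun u => u)); [apply cderiv_const | apply cderiv_id].
  + apply (cderiv_mult (fun _ => (k / 2)%C) (fun u => u * u)%C); [apply cderiv_const|].
    apply (cderiv_mult (fun u => u) (fun u => u)); apply cderiv_id.
- rewrite (Hg (t * z)%C).
  replace (g 0 + s (t * z) * (t * z - 0) - (g 0 + k * (t * z)))%C with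
    ((s (t * z)%C - k) * (t * z))%C by ring.
  rewrite Cmod_mult; apply Rmult_le_compat; try apply Cmod_ge_0; [|exact Hle].
  apply Rlt_le, Hsd; replace (t * z - 0)%C with (t * z)%C by ring; lra.
Qed.
Lemma taylor2_remainder (k : C -> C) : ccont k 0 -> taylor2 (fun z => k z * (z * z))%C 0 0 (k 0).
Proof. intros Hk; exists k; repeat split; [exact Hk | intros z; ring]. Qed.

Lemma taylor2_cderiv (f : C -> C) (a b c : C) : taylor2 f a b c -> cderiv f 0 b.
Proof.
intros (s & Hs & _ & Hf); exists (fun z => b + s z * z)%C; repeat split.
- ccont_auto.
- ring.
- intros z; rewrite !Hf; ring.
Qed.

(** * Caratheodory's inequality and subordination *)

(** Here polar 1 (- t) is exp(- i t), so the integrand is a combination of frequencies 1 and 2, with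
    the periodic primitive [K]. *)
Lemma trig_integral_zero (A B : C) :
  is_RInt (fun t => Re (A * (polar 1 (- t) * polar 1 (- t)) + B * polar 1 (- t))%C)
    0 (2 * PI) 0.
Proof.
destruct A as [A1 A2], B as [B1 B2].
pose (K := fun t => A1 * (sin t * cos t) + A2 * (sin t) ^ 2 + B1 * sin t - B2 * cos t).
replace 0 with (minus (K (2 * PI)) (K 0)) at 2
  by (unfold K, minus, plus, opp; simpl; rewrite sin_2PI, cos_2PI, sin_0, cos_0; ring).
apply (is_RInt_derive (V := R_CompleteNormedModule) K); intros t _.
- unfold K, polar, Re; auto_derive; [exact I|].
  simpl; rewrite sin_neg, cos_neg; ring.
- apply (ex_derive_continuous (V := R_NormedModule)).
  unfold polar, Re; simpl; auto_derive; exact I.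
Qed.

(* Integrate Re q against the nonnegative weight 1 + Re (mu z^2) / r^2 over the
   circle |z| = r, with mu = - c2 / |c2|: the mean is 1 - r^2 |c2| / 2. *)
Lemma caratheodory_coef2_radius (q : C -> C) (c1 c2 : C) (r : R) :
  (forall z : C, Cmod z < 1 -> exists l, cderiv q z l) ->
  (forall z : C, Cmod z < 1 -> 0 <= Re (q z)) ->
  taylor2 q 1 c1 c2 -> 0 < r < 1 -> Cmod c2 * r ^ 2 <= 2.
Proof.
intros Hq Hpos (s & Hs & Hs0 & Hqs) Hr.
assert (Hr2 : RtoC r <> 0) by (intros E; injection E; lra).
assert (H2 : RtoC 2 <> 0) by (intros E; injection E; lra).
destruct (Req_dec (Cmod c2) 0) as [Hc|Hc].
{ rewrite Hc; lra. }
pose proof (Cmod_ge_0 c2) as Hc0.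
assert (HcC : RtoC (Cmod c2) <> 0) by (intros E; injection E; lra).
set (mu := (- c2 / Cmod c2)%C).
assert (Hmu : Cmod mu = 1).
{ unfold mu; rewrite Cmod_div, Cmod_opp, Cmod_R, Rabs_pos_eq by assumption; field; exact Hc. }
assert (Hmuc : (Cconj mu * c2)%C = RtoC (- Cmod c2)).
{ assert (HI : (Cconj c2 * c2)%C = (Cmod c2 * Cmod c2)%C).
  { rewrite <- RtoC_mult; unfold Cmod; rewrite sqrt_sqrt by nra.
    unfold RtoC; destruct c2; unfold Cmult, Cconj; simpl; f_equal; ring. }
  replace (Cconj mu) with (- Cconj c2 / Cmod c2)%C.
  - replace (- Cconj c2 / Cmod c2 * c2)%C with (- (Cconj c2 * c2) / Cmod c2)%C
      by (field; exact HcC).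
    rewrite HI, RtoC_opp; field; exact HcC.
  - unfold mu, Cdiv; destruct c2; unfold Cmult, Cconj, Cinv, Copp; simpl; f_equal;
      unfold Rdiv; ring. }
(* On |z| = r the weight equals 1 + mu z^2 / (2 r^2) + conj(mu) r^2 / (2 z^2). In the last term, q /
   z^2 = (1 + c1 z) / z^2 + s: the singular part goes to [trig_integral_zero], and [G] collects the
   rest, which is continuous at 0. *)
set (G := fun z => (q z + mu / (2 * (r * r)) * (q z * (z * z)) +
  Cconj mu * (r * r) / 2 * s z)%C).
assert (Hint : is_RInt (fun t => Re (G (polar r t))) 0 (2 * PI) (2 * PI * Re (G 0))).
{ apply circle_mean_value; [| |exact Hr].
  - intros z Hz Hz1; destruct (Hq z Hz1) as [l Hl].
    (* Away from 0 the factor s is (q w - 1 - c1 w) / w^2, and the disc of radius |z| around z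
       avoids 0. *)
    assert (Hds : exists m, cderiv s z m).
    { eexists; apply (cderiv_ext_loc (fun w => (q w + (- (1)) * (1 + c1 * w)) * / (w * w))%C
        s z _ (Cmod z)); [apply Cmod_gt_0; exact Hz | |].
      - intros w Hw; rewrite Hqs; field; intros ->.
        replace (0 - z)%C with (- z)%C in Hw by ring; rewrite Cmod_opp in Hw; lra.
      - apply (cderiv_mult (fun w => q w + (- (1)) * (1 + c1 * w))%C (fun w => / (w * w))%C).
        + apply cderiv_plus; [exact Hl|].
          apply (cderiv_mult (fun _ => (- (1))%C) (fun w => 1 + c1 * w)%C); [apply cderiv_const|].
          apply cderiv_plus; [apply cderiv_const|].
          apply (cderiv_mult (fun _ => c1) (fun w => w)); [apply cderiv_const | apply cderiv_id].
        + apply (cderiv_inv (fun w => w * w)%C); [apply Cmult_neq_0; exact Hz|].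
          apply (cderiv_mult (fun w => w) (fun w => w)); apply cderiv_id. }
    destruct Hds as [m Hm]; eexists; unfold G.
    apply cderiv_plus; [apply cderiv_plus; [exact Hl|]|].
    + apply (cderiv_mult (fun _ => (mu / (2 * (r * r)))%C) (fun w => q w * (w * w))%C);
        [apply cderiv_const|].
      apply (cderiv_mult q (fun w => w * w)%C); [exact Hl|].
      apply (cderiv_mult (fun w => w) (fun w => w)); apply cderiv_id.
    + apply (cderiv_mult (fun _ => (Cconj mu * (r * r) / 2)%C) s); [apply cderiv_const | exact Hm].
  - assert (Hcq : ccont q 0).
    { destruct (Hq 0) as [l Hl]; [rewrite Cmod_0; lra | exact (cderiv_ccont _ _ _ Hl)]. }
    unfold G; ccont_auto. }
assert (HG0 : Re (G 0) = 1 - Cmod c2 * r ^ 2 / 2).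
{ unfold G; rewrite Hs0, Hqs.
  replace (_ + _)%C with (1 + r * r / 2 * (Cconj mu * c2))%C by (field; repeat split; assumption).
  rewrite Hmuc; replace (1 + r * r / 2 * RtoC (- Cmod c2))%C with
    (RtoC (1 - Cmod c2 * r ^ 2 / 2)); [reflexivity|].
  rewrite RtoC_minus, RtoC_div, RtoC_mult, RtoC_opp by lra; simpl.
  rewrite !RtoC_mult; field; exact H2. }
assert (Hsum := is_RInt_plus (V := R_NormedModule) _ _ _ _ _ _ Hint
  (trig_integral_zero (Cconj mu / 2) (Cconj mu * c1 * r / 2))).
assert (Hge : 0 <= 2 * PI * Re (G 0) + 0).
{ assert (Hconst := is_RInt_const (V := R_NormedModule) 0 (2 * PI) 0).
  pose proof PI_RGT_0.
  replace 0 with (scal (2 * PI - 0) 0) at 1 by (unfold scal; simpl; unfold mult; simpl; ring).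
  apply (is_RInt_le _ _ 0 (2 * PI) _ _ ltac:(lra) Hconst Hsum).
  intros t _.
  set (z := polar r t); set (zb := polar 1 (- t)).
  assert (Hz : Cmod z = r) by (apply Cmod_polar; lra).
  assert (Hzz : (z * zb)%C = RtoC r).
  { unfold z, zb, polar, Cmult, RtoC; simpl; rewrite cos_neg, sin_neg.
    pose proof (sin2_cos2 t) as T; unfold Rsqr in T; f_equal; [|ring].
    replace r with (r * (sin t * sin t + cos t * cos t)) at 3 by (rewrite T; ring); ring. }
  assert (Hw : Rabs (Re (mu * (z * z))) <= r ^ 2).
  { eapply Rle_trans; [eapply Rle_trans; [apply Rmax_l | apply Rmax_Cmod]|].
    rewrite !Cmod_mult, Hmu, Hz; lra. }
  change (0 <= Re (G z) + Re (Cconj mu / 2 * (zb * zb) + Cconj mu * c1 * r / 2 * zb)%C).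
  replace (Re (G z) + Re (Cconj mu / 2 * (zb * zb) + Cconj mu * c1 * r / 2 * zb)%C)
    with (Re (q z) * (1 + Re (mu * (z * z)) / r ^ 2)).
  - apply Rmult_le_pos; [apply Hpos; lra|].
    apply Rabs_le_between in Hw; apply Rmult_le_reg_r with (r ^ 2); [apply pow_lt; lra|].
    replace ((1 + Re (mu * (z * z)) / r ^ 2) * r ^ 2) with (r ^ 2 + Re (mu * (z * z))%C)
      by (field; lra).
    lra.
  (* [nu] is the conjugate of mu z^2 / r^2, so the weight is 1 + (nu + conj(nu)) / 2. *)
  - set (nu := (Cconj mu * (zb * zb))%C).
    assert (Hnu : (mu * (z * z))%C = (r * r * Cconj nu)%C).
    { unfold nu, z, zb, polar; rewrite cos_neg, sin_neg; destruct mu as [m1 m2].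
      unfold Cmult, Cconj, RtoC; simpl; f_equal; ring. }
    assert (HRe : Re (mu * (z * z)) / r ^ 2 = Re nu).
    { rewrite Hnu; unfold Re, Cmult, Cconj, RtoC; simpl; field; lra. }
    assert (Hsum2 : (Cconj nu + nu)%C = RtoC (2 * Re nu)).
    { unfold Re, Cplus, Cconj, RtoC; simpl; f_equal; ring. }
    assert (HGz : (G z + (Cconj mu / 2 * (zb * zb) + Cconj mu * c1 * r / 2 * zb))%C =
      (q z * RtoC (1 + Re (mu * (z * z)) / r ^ 2))%C).
    { rewrite HRe; replace (RtoC (1 + Re nu)) with (1 + (Cconj nu + nu) / 2)%C
        by (rewrite Hsum2, RtoC_plus, RtoC_mult; field; exact H2).
      replace (Cconj nu) with (mu * (z * z) / (r * r))%C
        by (rewrite Hnu; field; exact Hr2).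
      unfold G.
      replace (Cconj mu * (r * r) / 2 * s z)%C
        with (Cconj mu / 2 * (q z - (1 + c1 * z)) * (zb * zb))%C.
      - replace (Cconj mu / 2 * (q z - (1 + c1 * z)) * (zb * zb))%C with
          (Cconj mu / 2 * (q z - 1) * (zb * zb) - Cconj mu / 2 * c1 * (z * zb) * zb)%C
          by (field; exact H2).
        rewrite Hzz; unfold nu; field; repeat split; assumption.
      - rewrite Hqs, <- Hzz; field; exact H2. }
    apply (f_equal Re) in HGz.
    transitivity (Re (q z * RtoC (1 + Re (mu * (z * z)) / r ^ 2))%C).
    + unfold Re, Cmult, RtoC; simpl; ring.
    + rewrite <- HGz; reflexivity. }
rewrite HG0 in Hge.
pose proof PI_RGT_0.
assert (0 <= 1 - Cmod c2 * r ^ 2 / 2) by (apply Rmult_le_reg_l with (2 * PI); lra).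
lra.
Qed.

Lemma caratheodory_coef2 (q : C -> C) (c1 c2 : C) :
  (forall z : C, Cmod z < 1 -> exists l, cderiv q z l) ->
  (forall z : C, Cmod z < 1 -> 0 <= Re (q z)) ->
  taylor2 q 1 c1 c2 -> Cmod c2 <= 2.
Proof.
intros Hq Hpos Ht; apply Rnot_lt_le; intros Hlt.
set (m := Cmod c2) in *.
assert (Hx : 0 < 2 / m < 1).
{ split; [apply Rdiv_lt_0_compat; lra | apply Rlt_div_l; lra]. }
(* With x = 2 / m < 1, the radius (1 + x) / 2 satisfies ((1 + x) / 2)^2 = x + ((1 - x) / 2)^2 > x,
   so m r^2 > 2, a contradiction. *)
assert (H := caratheodory_coef2_radius q c1 c2 ((1 + 2 / m) / 2) Hq Hpos Ht ltac:(lra)).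
fold m in H.
assert (Hm : m * ((1 + 2 / m) / 2) ^ 2 = 2 + m * ((1 - 2 / m) / 2) ^ 2) by (field; lra).
assert (0 < m * ((1 - 2 / m) / 2) ^ 2) by (apply Rmult_lt_0_compat; [lra | apply pow_lt; lra]).
lra.
Qed.

(** The second coefficient of q = (1 + omega) / (1 - omega) is 2 (u2 + u1^2). The bound on u1 comes
    from the same inequality for z -> q(z^2), whose second coefficient is 2 u1. *)
Lemma schwarz_coefficients (omega : C -> C) (u1 u2 : C) :
  (forall z : C, Cmod z < 1 -> exists l, cderiv omega z l) ->
  (forall z : C, Cmod z < 1 -> Cmod (omega z) < 1) ->
  taylor2 omega 0 u1 u2 -> Cmod u1 <= 1 /\ Cmod (u2 + u1 * u1) <= 1.
Proof.
intros Hd Hmod Ht.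
set (q := fun z => ((1 + omega z) * / (1 + - (1) * omega z))%C).
assert (Hden : forall z : C, Cmod z < 1 -> (1 + - (1) * omega z)%C <> 0).
{ intros z Hz E; specialize (Hmod z Hz).
  replace (omega z) with (RtoC 1) in Hmod; [rewrite Cmod_1 in Hmod; lra|].
  apply Ceq_minus; rewrite <- E; ring. }
assert (Hq : forall z : C, Cmod z < 1 -> exists l, cderiv q z l).
{ intros z Hz; destruct (Hd z Hz) as [l Hl]; eexists; unfold q.
  apply (cderiv_mult (fun z => 1 + omega z)%C (fun z => / (1 + - (1) * omega z))%C).
  - apply cderiv_plus; [apply cderiv_const | exact Hl].
  - apply (cderiv_inv (fun z => 1 + - (1) * omega z)%C); [apply Hden, Hz|].
    apply cderiv_plus; [apply cderiv_const|].
    apply (cderiv_mult (fun _ => - (1))%C omega); [apply cderiv_const | exact Hl]. }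
assert (Hpos : forall z : C, Cmod z < 1 -> 0 <= Re (q z)).
{ intros z Hz; pose proof (Hden z Hz) as Hn; specialize (Hmod z Hz); unfold q.
  revert Hn Hmod; generalize (omega z); intros [a b] Hn Hmod.
  assert (Hab : a ^ 2 + b ^ 2 < 1).
  { unfold Cmod in Hmod; simpl fst in Hmod; simpl snd in Hmod.
    rewrite <- sqrt_1 in Hmod; apply sqrt_lt_0_alt in Hmod; exact Hmod. }
  unfold Re, Cinv, Cmult, Cplus, RtoC; simpl.
  (* [D] is |1 - omega|^2 as unfolding displays it; the real part of q is (1 - |omega|^2) / D. *)
  set (D := (1 + (- (1) * a - - 0 * b)) * ((1 + (- (1) * a - - 0 * b)) * 1) +
    (0 + (- (1) * b + - 0 * a)) * ((0 + (- (1) * b + - 0 * a)) * 1)).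
  assert (HD : 0 < D) by (unfold D; nra).
  replace (_ - _) with ((1 - (a ^ 2 + b ^ 2)) / D).
  - apply Rlt_le, Rdiv_lt_0_compat; lra.
  - field; lra. }
assert (Htq : taylor2 q 1 (2 * u1) (2 * (u2 + u1 * u1))).
{ eapply taylor2_coef.
  - apply (taylor2_mult (fun z => 1 + omega z)%C (fun z => / (1 + - (1) * omega z))%C).
    + apply (taylor2_plus (fun _ => RtoC 1)); [apply taylor2_const | exact Ht].
    + apply (taylor2_Cinv_1 (fun z => 1 + - (1) * omega z)%C).
      eapply taylor2_coef.
      * apply (taylor2_plus (fun _ => RtoC 1)); [apply taylor2_const |].
        apply (taylor2_mult (fun _ => (- (1))%C) omega); [apply taylor2_const | exact Ht].
      * ring.
      * reflexivity.
      * reflexivity.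
  - ring.
  - ring.
  - ring. }
assert (Hsq : forall z : C, Cmod z < 1 -> Cmod (z * z) < 1).
{ intros z Hz; rewrite Cmod_mult; pose proof (Cmod_ge_0 z); nra. }
assert (Htq2 : taylor2 (fun z => q (z * z)%C) 1 0 (2 * u1)).
{ eapply taylor2_coef.
  - apply (taylor2_comp q (fun z => z * z)%C); [exact Htq|].
    eapply taylor2_coef; [apply (taylor2_mult (fun z => z) (fun z => z)); apply taylor2_id | | |];
      [ring | reflexivity | reflexivity].
  - reflexivity.
  - ring.
  - ring. }
apply caratheodory_coef2 in Htq; [|exact Hq | exact Hpos].
apply caratheodory_coef2 in Htq2.
- rewrite Cmod_mult, Cmod_R, Rabs_pos_eq in Htq, Htq2 by lra; lra.
- intros z Hz; destruct (Hq _ (Hsq z Hz)) as [l Hl]; eexists.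
  apply (cderiv_comp q (fun z => z * z)%C); [exact Hl|].
  apply (cderiv_mult (fun w => w) (fun w => w)); apply cderiv_id.
- intros z Hz; apply Hpos, Hsq, Hz.
Qed.

(** The second order expansion of omega is solved from g = phi(omega): b1 omega = g - 1 - p(omega)
    omega^2, where omega = z t(z) turns omega^2 into a term of order two with leading coefficient b2
    u^2. *)
Lemma subordination_coef2 (phi g omega : C -> C) (b1 b2 : R) (c1 c2 : C) :
  0 < b1 -> taylor2 phi 1 b1 b2 -> taylor2 g 1 c1 c2 ->
  (forall z : C, Cmod z < 1 -> exists l, cderiv omega z l) ->
  (forall z : C, Cmod z < 1 -> Cmod (omega z) < 1) -> omega 0 = 0 ->
  (forall z : C, Cmod z < 1 -> g z = phi (omega z)) ->
  Cmod c2 <= b1 + Rabs (b2 - b1).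
Proof.
intros Hb1 (p & Hp & Hp0 & Hphi) Hg Hd Hmod H0 Hgphi.
assert (Hb : RtoC b1 <> 0) by (intros E; injection E; lra).
destruct (Hd 0) as [u Hu]; [rewrite Cmod_0; lra|].
pose proof (cderiv_ccont _ _ _ Hu) as Hc.
pose proof Hu as (t & Ht & Ht0 & Hom).
assert (Htay : taylor2 omega 0 (/ b1 * c1) (/ b1 * (c2 - b2 * (u * u)))).
{ apply (taylor2_ext_loc (fun z => / b1 * (g z + (- (1) +
    - (p (omega z) * (t z * t z)) * (z * z))))%C _ _ _ _ 1 Rlt_0_1).
  { intros z Hz; rewrite Hgphi, Hphi by exact Hz.
    set (k := p (omega z)).
    replace (omega z * omega z)%C with (t z * t z * (z * z))%C
      by (rewrite Hom, H0; ring).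
    field; exact Hb. }
  assert (Hk : ccont (fun z => - (p (omega z) * (t z * t z)))%C 0).
  { ccont_auto; apply (ccont_comp p omega); [exact Hc | rewrite H0; exact Hp]. }
  eapply taylor2_coef.
  - apply (taylor2_mult (fun _ => / b1)%C); [apply taylor2_const|].
    apply taylor2_plus; [exact Hg|].
    apply (taylor2_plus (fun _ => - (1))%C); [apply taylor2_const|].
    apply (taylor2_remainder _ Hk).
  - ring.
  - ring.
  - rewrite H0, Hp0, Ht0; ring. }
(* The derivative of omega at 0 and the first coefficient of its expansion agree, so the Schwarz
   bounds apply to u. *)
assert (Hu1 : u = (/ b1 * c1)%C).
{ apply (cderiv_unique omega 0); [exact Hu | exact (taylor2_cderiv _ _ _ _ Htay)]. }
destruct (schwarz_coefficients _ _ _ Hd Hmod Htay) as [B1 B2].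
rewrite <- Hu1 in B1, B2.
set (u2 := (/ b1 * (c2 - b2 * (u * u)))%C) in *.
replace c2 with (b1 * (u2 + u * u) + RtoC (b2 - b1) * (u * u))%C
  by (unfold u2; rewrite RtoC_minus; field; exact Hb).
eapply Rle_trans; [apply Cmod_triangle|].
rewrite !Cmod_mult, !Cmod_R, (Rabs_pos_eq b1) by lra.
pose proof (Cmod_ge_0 u); pose proof (Rabs_pos (b2 - b1)).
apply Rplus_le_compat.
- rewrite <- (Rmult_1_r b1) at 2; apply Rmult_le_compat_l; lra.
- rewrite <- (Rmult_1_r (Rabs (b2 - b1))) at 2; apply Rmult_le_compat_l; [lra | nra].
Qed.
(** * Coefficients *)

Lemma taylor2_id_mult (f : C -> C) (c : C) : cderiv f 0 c -> taylor2 (fun z => z * f z)%C 0 (f 0) c.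
Proof.
intros (s & Hs & <- & Hf); exists s; repeat split; [exact Hs|].
intros z; rewrite Hf; ring.
Qed.

(** Differentiate f(F v) = v, which holds on the disc of radius r - |w| around w. *)
Lemma inverse_derivative (f f1 F F1 : C -> C) (r : R) (w : C) :
  (forall z : C, Cmod z < 1 -> cderiv f z (f1 z)) -> cderiv F w (F1 w) ->
  (forall v : C, Cmod v < r -> Cmod (F v) < 1 /\ f (F v) = v) -> Cmod w < r ->
  (f1 (F w) * F1 w)%C = 1.
Proof.
intros Hf HF Hinv Hw.
apply (cderiv_unique (fun v => v) w); [|apply cderiv_id].
apply (cderiv_ext_loc (fun v => f (F v)) _ _ _ (r - Cmod w)); [lra | |].
- intros v Hv; apply Hinv; pose proof (Cmod_minus_lower w v) as L.
  rewrite <- (Cmod_opp (w - v)) in L; replace (- (w - v))%C with (v - w)%C in L by ring; lra.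
- apply (cderiv_comp f F); [apply Hf, Hinv, Hw | exact HF].
Qed.

(** Near 0, F' = 1 / f'(F). Expanding the right side involves the unknown k = F''(0); the first
    order terms then give k = - f''(0), which is substituted back into the second order term. *)
Lemma taylor2_inverse_derivative (f f1 f2 F F1 : C -> C) (r : R) (c k : C) :
  (forall z : C, Cmod z < 1 -> cderiv f z (f1 z)) ->
  (forall z : C, Cmod z < 1 -> cderiv f1 z (f2 z)) -> cderiv f2 0 c ->
  (forall z : C, Cmod z < 1 -> cderiv F z (F1 z)) -> cderiv F1 0 k ->
  f1 0 = 1 -> F 0 = 0 -> 0 < r ->
  (forall w : C, Cmod w < r -> Cmod (F w) < 1 /\ f (F w) = w) ->
  taylor2 F1 1 (- f2 0) (3 / 2 * (f2 0 * f2 0) - c / 2).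
Proof.
intros Hf Hf1 Hf2 HF HF1 Hf10 HF0 Hr Hinv.
assert (H2 : RtoC 2 <> 0) by (intros E; injection E; lra).
assert (Hprod : forall w : C, Cmod w < Rmin r 1 -> (f1 (F w) * F1 w)%C = 1).
{ intros w Hw; pose proof (Rmin_l r 1); pose proof (Rmin_r r 1).
  apply (inverse_derivative f f1 F F1 r); try assumption; [apply HF|]; lra. }
assert (Hm : 0 < Rmin r 1) by (apply Rmin_pos; lra).
assert (HF10 : F1 0 = 1).
{ specialize (Hprod 0); rewrite Cmod_0, HF0, Hf10, Cmult_1_l in Hprod; apply Hprod, Hm. }
assert (T1 := taylor2_of_derivatives f1 f2 c Hf1 Hf2).
assert (TF := taylor2_of_derivatives F F1 k HF HF1).
rewrite Hf10 in T1; rewrite HF0, HF10 in TF.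
assert (T := taylor2_Cinv_1 _ _ _ (taylor2_comp _ _ _ _ _ _ _ T1 TF)).
apply (taylor2_ext_loc _ F1 _ _ _ _ Hm) in T.
- assert (Hk : k = (- (f2 0 * 1))%C)
    by exact (cderiv_unique _ _ _ _ HF1 (taylor2_cderiv _ _ _ _ T)).
  eapply taylor2_coef; [exact T | reflexivity | ring |].
  rewrite Hk; field; exact H2.
- intros w Hw; specialize (Hprod w Hw).
  assert (Hn : f1 (F w) <> 0).
  { intros E; rewrite E, Cmult_0_l in Hprod; apply C1_nz; symmetry; exact Hprod. }
  transitivity ((f1 (F w) * F1 w) / f1 (F w))%C; [rewrite Hprod|]; field; exact Hn.
Qed.

(** Here d stands for 2 a2 and c for 6 a3; the triangle inequality for P + 2 Q = 8 a2^2 and 3 P + 2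
    Q = 12 a3 gives 3 M and 5 M. *)
Lemma coefficient_bounds (d c : C) (M : R) :
  Cmod (c - d * d) <= M -> Cmod (3 / 2 * (d * d) - c / 2) <= M ->
  Cmod (d / 2) <= sqrt (3 * M / 8) /\ Cmod (c / 6) <= 5 * M / 12.
Proof.
intros HP HQ.
assert (H2 : RtoC 2 <> 0) by (intros E; injection E; lra).
assert (H6 : RtoC 6 <> 0) by (intros E; injection E; lra).
set (P := (c - d * d)%C) in *; set (Q := (3 / 2 * (d * d) - c / 2)%C) in *.
split.
- rewrite <- (sqrt_pow2 (Cmod (d / 2))) by apply Cmod_ge_0; apply sqrt_le_1_alt.
  assert (E : (8 * (d / 2 * (d / 2)))%C = (P + 2 * Q)%C) by (unfold P, Q; field; exact H2).
  apply (f_equal Cmod) in E; pose proof (Cmod_triangle P (2 * Q)) as T.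
  rewrite <- E, !Cmod_mult, !Cmod_R, !Rabs_pos_eq in T by lra.
  lra.
- assert (E : (12 * (c / 6))%C = (3 * P + 2 * Q)%C)
    by (unfold P, Q; field; repeat split; assumption).
  apply (f_equal Cmod) in E; pose proof (Cmod_triangle (3 * P) (2 * Q)) as T.
  rewrite <- E, !Cmod_mult, !Cmod_R, !Rabs_pos_eq in T by lra.
  lra.
Qed.

Lemma convex_inverse_coefficients
  (phi p1 p2 f f1 f2 f3 F F1 u v : C -> C) (b1 b2 r : R) :
  (forall z : C, Cmod z < 1 -> cderiv phi z (p1 z)) ->
  (forall z : C, Cmod z < 1 -> cderiv p1 z (p2 z)) ->
  phi 0 = 1 -> p1 0 = b1 -> 0 < b1 -> (p2 0 / 2)%C = b2 ->
  (forall z : C, Cmod z < 1 -> cderiv f z (f1 z)) ->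
  (forall z : C, Cmod z < 1 -> cderiv f1 z (f2 z)) ->
  (forall z : C, Cmod z < 1 -> cderiv f2 z (f3 z)) ->
  f1 0 = 1 ->
  (forall z : C, Cmod z < 1 -> cderiv F z (F1 z)) -> F 0 = 0 -> 0 < r ->
  (forall w : C, Cmod w < r -> Cmod (F w) < 1 /\ f (F w) = w) ->
  (forall z : C, Cmod z < 1 -> exists l, cderiv u z l) -> u 0 = 0 ->
  (forall z : C, Cmod z < 1 -> Cmod (u z) < 1 /\ (1 + z * f2 z / f1 z)%C = phi (u z)) ->
  (forall z : C, Cmod z < 1 -> exists l, cderiv v z l) -> v 0 = 0 ->
  (forall z : C, Cmod z < 1 -> Cmod (v z) < 1 /\ F1 z = phi (v z)) ->
  Cmod (f2 0 / 2) <= sqrt (3 * (b1 + Rabs (b2 - b1)) / 8) /\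
  Cmod (f3 0 / 6) <= 5 * (b1 + Rabs (b2 - b1)) / 12.
Proof.
intros Hp Hp1 Hphi0 Hb1 Hb1pos Hb2 Hf Hf1 Hf2 Hf10 HF HF0 Hr Hinv Hu Hu0 Hfu Hv Hv0 HFv.
assert (D0 : Cmod 0 < 1) by (rewrite Cmod_0; lra).
assert (Tphi := taylor2_of_derivatives phi p1 _ Hp (Hp1 0 D0)).
rewrite Hphi0, Hb1, Hb2 in Tphi.
apply coefficient_bounds.
- apply (subordination_coef2 phi (fun z => 1 + z * f2 z / f1 z)%C u b1 b2 (f2 0)); try assumption;
    try (intros z Hz; apply Hfu, Hz).
  assert (T1 := taylor2_of_derivatives f1 f2 _ Hf1 (Hf2 0 D0)); rewrite Hf10 in T1.
  (* Multiplying f2 0 z + f3 0 z^2 by 1 - f2 0 z leaves f3 0 - (f2 0)^2 in degree two. *)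
  eapply taylor2_coef.
  + apply (taylor2_plus (fun _ => RtoC 1)); [apply taylor2_const|].
    apply (taylor2_mult (fun z => z * f2 z)%C (fun z => / f1 z)%C).
    * apply taylor2_id_mult, (Hf2 0 D0).
    * apply taylor2_Cinv_1, T1.
  + ring.
  + ring.
  + ring.
- apply (subordination_coef2 phi F1 v b1 b2 (- f2 0)); try assumption;
    try (intros z Hz; apply HFv, Hz).
  (* The derivative of F' at 0 is supplied by F' = phi(v) and the chain rule. *)
  destruct (Hv 0 D0) as [l Hl].
  apply (taylor2_inverse_derivative f f1 f2 F F1 r (f3 0) (p1 0 * l)%C); try assumption.
  + apply Hf2, D0.
  + apply (cderiv_ext_loc (fun z => phi (v z)) _ _ _ 1 Rlt_0_1).
    * intros w Hw; replace (w - 0)%C with w in Hw by ring; symmetry; apply HFv, Hw.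
    * apply (cderiv_comp phi v); [rewrite Hv0; apply Hp, D0 | exact Hl].
Qed.

(* Imported only here, since Defs redefines the names Cmod, RtoC, Cinv, Cdiv of
   Coquelicot; the two sets of complex operations are convertible. *)
Require Import Defs.

Lemma has_cderiv_cderiv (f : C -> C) (z l : C) : has_cderiv f z l <-> cderiv f z l.
Proof. rewrite cderivP; reflexivity. Qed.

(* f, F, phi are given with their successive complex derivatives on D
   (f1 = f', f2 = f'', f3 = f'''; F1 = F'; p1 = phi', p2 = phi'').
   Taylor coefficients: a2 = f''(0)/2, a3 = f'''(0)/6, B1 = phi'(0), B2 = phi''(0)/2. *)
Theorem theorem4
  (phi p1 p2 : Cx -> Cx) (b1 b2 : R)
  (f f1 f2 f3 F F1 : Cx -> Cx)
  (Hp1 : is_deriv_on_D phi p1) (Hp2 : is_deriv_on_D p1 p2)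
  (Hphi0 : phi Czero = Cone)
  (HB1 : p1 Czero = RtoC b1) (Hb1pos : 0 < b1)
  (HB2 : Cdiv (p2 Czero) (RtoC 2) = RtoC b2)
  (Hf1 : is_deriv_on_D f f1) (Hf2 : is_deriv_on_D f1 f2) (Hf3 : is_deriv_on_D f2 f3)
  (Hf0 : f Czero = Czero) (Hf10 : f1 Czero = Cone)
  (Hfuniv : univalent_on_D f)
  (HF1 : is_deriv_on_D F F1) (HFuniv : univalent_on_D F)
  (HFinv : exists r : R, 0 < r /\
     forall w : Cx, Cmod w < r -> inD (F w) /\ f (F w) = w)
  (HK : subordinate (fun z => Cadd Cone (Cdiv (Cmul z (f2 z)) (f1 z))) phi)
  (HR : subordinate F1 phi) :
  Cmod (Cdiv (f2 Czero) (RtoC 2)) <= sqrt (3 * (b1 + Rabs (b2 - b1)) / 8) /\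
  Cmod (Cdiv (f3 Czero) (RtoC 6)) <= 5 * (b1 + Rabs (b2 - b1)) / 12.

Proof.
destruct HFinv as (r & Hr & Hinv).
destruct HK as (u & Hu & Hu0 & HKu), HR as (v & Hv & Hv0 & HRv).
assert (H0 : forall a, 0 < a -> Cmod Czero < a).
{ intros a Ha; change (Complex.Cmod (Complex.RtoC 0) < a); rewrite Complex.Cmod_0; exact Ha. }
(* Both F 0 and 0 are sent to 0 by f, which is univalent. *)
assert (HF0 : F Czero = Czero).
{ destruct (Hinv Czero) as [HD HfF]; [apply H0, Hr|].
  apply Hfuniv; [exact HD | apply H0, Rlt_0_1 |].
  rewrite HfF, Hf0; reflexivity. }
apply (convex_inverse_coefficients phi p1 p2 f f1 f2 f3 F F1 u v b1 b2 r); try assumption;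
  intros z Hz.
- apply has_cderiv_cderiv, Hp1, Hz.
- apply has_cderiv_cderiv, Hp2, Hz.
- apply has_cderiv_cderiv, Hf1, Hz.
- apply has_cderiv_cderiv, Hf2, Hz.
- apply has_cderiv_cderiv, Hf3, Hz.
- apply has_cderiv_cderiv, HF1, Hz.
- destruct (Hu z Hz) as [l Hl]; exists l; apply has_cderiv_cderiv, Hl.
- destruct (Hv z Hz) as [l Hl]; exists l; apply has_cderiv_cderiv, Hl.
Qed.
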